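(* Let $q$ be a prime power, $n\geq 5$ and $U=U_n(q)$. Each irreducible character of $U$ of second largest degree $q^{\mu(n)-1}$ is of one of the following forms, where characters of the subgroups $U_{\alpha_{a,b}}$ are regarded as characters of $U$ by inflation: (i) the tensor product of an almost faithful elementary character of $U$ with an irreducible character of $U_{\alpha_{2,n-2}}\simeq U_{n-2}(q)$ of degree $q^{\mu(n-2)-1}$; (ii) the tensor product of an irreducible constituent of ${\lambda_1}^U\otimes{\lambda_2}^U$, where ${\lambda_1}^U,{\lambda_2}^U$ are elementary characters associated to $\alpha_{1,n-2}$ and $\alpha_{2,n-1}$ respectively, with an irreducible character of $U_{\alpha_{3,n-3}}\simeq U_{n-4}(q)$ of largest degree $q^{\mu(n-4)}$. Therefore, \[N_{n,\mu(n)-1}(q)=(q-1)N_{n-2,\mu(n-2)-1}(q)+q(q-1)^2N_{n-4,\mu(n-4)}(q).\]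
   Context: Let $q$ be a prime power and $U=U_n(q)$ the group of upper triangular $n\times n$ matrices over $\mathbb{F}_q$ with all diagonal entries $1$. All characters are complex. For $1\le i\le j\le n-1$, $\alpha_{i,j}=\alpha_i+\dots+\alpha_j$ denotes the positive roots of type $A_{n-1}$; $\Sigma^+$ is the set of all of them, and $X_{\alpha_{i,j}}=\{I_n+c\,e_{i,j+1}:c\in\mathbb{F}_q\}$ is the root subgroup, where $e_{i,j+1}$ is the matrix unit. For $\alpha=\alpha_{i,j}$: $arm(\alpha)=\{\alpha_{i,t}: i\le t<j\}$; $V_\alpha=\langle X_\beta:\beta\in\Sigma^+\setminus arm(\alpha)\rangle$. $\mathrm{Irr}(V_\alpha/[V_\alpha,V_\alpha])^*$ denotes the set of the $q-1$ linear characters $\lambda$ of $V_\alpha$ with $\lambda|_{X_\alpha}\ne 1_{X_\alpha}$ and $\lambda|_{X_\beta}=1_{X_\beta}$ for all $X_\beta\subset V_\alpha$, $\beta\neq\alpha$. For such $\lambda$, the induced character $\lambda^U$ is called an elementary character associated to $\alpha$. A character $\chi$ of a group $G$ is almost faithful if $\chi|_{Z(G)}\ne\chi(1)1_{Z(G)}$ (the almost faithful elementary characters of $U$ are those associated to $\alpha_{1,n-1}$). $U_{\alpha_{a,b}}=\langle X_{\alpha_{s,t}}: a\le s\le t\le b\rangle$ (interpreted as the trivial group when $b=a-1$), and $R_{\alpha_{a,b}}$ is the normal subgroup of $U$ generated by all $X_\beta$ not contained in $U_{\alpha_{a,b}}$. One has $U=R_{\alpha_{a,b}}\rtimes U_{\alpha_{a,b}}$,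 and characters of $U_{\alpha_{a,b}}$ are inflated to $U$ with $R_{\alpha_{a,b}}$ in the kernel. $N_{n,e}(q)$ is the number of irreducible characters of $U_n(q)$ of degree $q^e$. $\mu(n)=m(m-1)$ if $n=2m$ and $\mu(n)=m^2$ if $n=2m+1$; the irreducible character degrees of $U_n(q)$ are precisely $q^e$, $0\le e\le\mu(n)$. *)

(* Defs.v *)
From mathcomp Require Import all_boot all_order all_algebra all_fingroup.
From mathcomp Require Import all_solvable all_field all_character.

Set Implicit Arguments.
Unset Strict Implicit.
Unset Printing Implicit Defensive.

Import GRing.Theory.
Import GroupScope.
Local Open Scope ring_scope.

Definition unitri_mx (R : nzRingType) (m : nat) (A : 'M[R]_m) : bool :=
  is_trig_mx A^T && [forall i, A i i == 1].

Lemma unitri_mxP (R : nzRingType) (m : nat) (A : 'M[R]_m) :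
  reflect (forall i j : 'I_m, (j <= i)%N -> A i j = (i == j)%:R)
          (unitri_mx A).
Proof.
apply: (iffP andP) => [[/is_trig_mxP tA /forallP dA] i j | H].
  rewrite leq_eqVlt => /orP[/eqP/val_inj ->|lt_ji].
    by rewrite eqxx; apply/eqP.
  by have := tA j i lt_ji; rewrite mxE => ->; rewrite -val_eqE /= gtn_eqF.
split; last by apply/forallP=> i; rewrite H // eqxx.
apply/is_trig_mxP=> i j lt_ij; rewrite mxE H 1?ltnW //.
by rewrite -val_eqE /= gtn_eqF.
Qed.

(* {'GL_n[F]} consists of matrices of size n.-1.+1, which is n for n > 0;
   all the definitions below are meant for n > 0. *)
Definition unitri (F : finFieldType) (n : nat) : {set {'GL_n[F]}} :=
  [set g : {'GL_n[F]} | unitri_mx (GLval g)].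

Lemma unitriP (F : finFieldType) (n : nat) (g : {'GL_n[F]}) :
  reflect (forall i j : 'I_n.-1.+1, (j <= i)%N -> GLval g i j = (i == j)%:R)
          (g \in unitri F n).
Proof. by rewrite inE; apply: unitri_mxP. Qed.

Lemma unitri_group_set (F : finFieldType) (n : nat) : group_set (unitri F n).
Proof.
apply/group_setP; split.
  by apply/unitriP=> i j _; rewrite GL_1E mxE.
move=> x y /unitriP Hx /unitriP Hy; apply/unitriP=> i j le_ji.
rewrite GL_MxE mxE (bigD1 i) //= Hx // eqxx mul1r Hy // big1 ?addr0 // => k nki.
case: (ltnP k i) => [lt_ki|le_ik].
  by rewrite Hx 1?ltnW // eq_sym (negPf nki) mul0r.
have lt_ik : (i < k)%N by rewrite ltn_neqAle le_ik andbT eq_sym val_eqE.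
rewrite Hy; last by rewrite ltnW // (leq_ltn_trans le_ji).
by rewrite -val_eqE /= gtn_eqF ?mulr0 // (leq_ltn_trans le_ji).
Qed.

Canonical unitri_group (F : finFieldType) (n : nat) : {group {'GL_n[F]}} :=
  Group (unitri_group_set F n).

(* The root alpha_i + ... + alpha_j is encoded by the pair of numbers (i, j),
   counted from 1 as usual. *)
Definition posroot (n i j : nat) : bool := (0 < i <= j)%N && (j < n)%N.

(* Matrix indices start at 0, so e_(i, j+1) is the entry (i.-1, j). *)
Definition rootsub (F : finFieldType) (n i j : nat) : {set {'GL_n[F]}} :=
  [set g : {'GL_n[F]} |
    [exists c : F, GLval g == 1%:M + c *: delta_mx (inord i.-1) (inord j)]].

Lemma rootsub_group_set (F : finFieldType) (n i j : nat) :
  group_set (rootsub F n i j).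
Proof.
apply/group_setP; split.
  by rewrite inE; apply/existsP; exists 0; rewrite GL_1E scale0r addr0.
move=> x y; rewrite !inE => /existsP[c /eqP Hx] /existsP[d /eqP Hy].
set r := inord i.-1 in Hx Hy *; set s := inord j in Hx Hy *.
apply/existsP; exists (c + d + c * d * (s == r)%:R).
rewrite GL_MxE Hx Hy mulmxDl mulmxDr !mul1mx mulmxDr mulmx1 -scalemxAl -scalemxAr.
have -> : delta_mx r s *m delta_mx r s = (s == r)%:R *: delta_mx r s :> 'M[F]_n.-1.+1.
  have [->|ne] := eqVneq s r; first by rewrite mul_delta_mx scale1r.
  by rewrite mul_delta_mx_0 // scale0r.
rewrite !scalerA !scalerDl -!addrA; apply/eqP; congr (_ + _).
by rewrite addrCA.
Qed.

Canonical rootsub_group (F : finFieldType) (n i j : nat) : {group {'GL_n[F]}} :=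
  Group (rootsub_group_set F n i j).

Definition rootgen (F : finFieldType) (n : nat) (P : nat -> nat -> bool) :
    {set {'GL_n[F]}} :=
  << \bigcup_(s < n) \bigcup_(t < n | posroot n s t && P s t)
       rootsub F n s t >>.

Canonical rootgen_group (F : finFieldType) (n : nat) (P : nat -> nat -> bool) :
  {group {'GL_n[F]}} := Eval hnf in [group of rootgen F n P].

Definition arm (i j s t : nat) : bool := (s == i) && (i <= t < j)%N.

Definition Vgrp (F : finFieldType) (n i j : nat) : {set {'GL_n[F]}} :=
  rootgen F n (fun s t => ~~ arm i j s t).

Canonical Vgrp_group (F : finFieldType) (n i j : nat) : {group {'GL_n[F]}} :=
  Eval hnf in [group of Vgrp F n i j].

Definition Ublock (F : finFieldType) (n a b : nat) : {set {'GL_n[F]}} :=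
  rootgen F n (fun s t => (a <= s)%N && (t <= b)%N).

Canonical Ublock_group (F : finFieldType) (n a b : nat) : {group {'GL_n[F]}} :=
  Eval hnf in [group of Ublock F n a b].

Definition Rblock (F : finFieldType) (n a b : nat) : {set {'GL_n[F]}} :=
  << class_support
       (\bigcup_(s < n)
          \bigcup_(t < n |
             posroot n s t && ~~ (rootsub F n s t \subset Ublock F n a b))
            rootsub F n s t)
       (unitri F n) >>.

Canonical Rblock_group (F : finFieldType) (n a b : nat) : {group {'GL_n[F]}} :=
  Eval hnf in [group of Rblock F n a b].

Lemma rootgen_subP (F : finFieldType) (n : nat) (P : nat -> nat -> bool)
    (G : {group {'GL_n[F]}}) :
  reflect (forall s t, posroot n s t -> P s t -> rootsub F n s t \subset G)
          (rootgen F n P \subset G).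
Proof.
rewrite gen_subG; apply: (iffP bigcupsP) => [H s t st Pst | H s _].
  have /andP[/andP[_ le_st] lt_tn] := st.
  have /bigcupsP := H (Ordinal (leq_ltn_trans le_st lt_tn)) isT.
  by move/(_ (Ordinal lt_tn)); apply; rewrite /= st.
by apply/bigcupsP=> t /andP[]; apply: H.
Qed.

Lemma rootsubP (F : finFieldType) (n i j : nat) (g : {'GL_n[F]}) :
  posroot n i j -> g \in rootsub F n i j ->
  exists c : F, forall r s : 'I_n.-1.+1,
    GLval g r s = (r == s)%:R + c * ((r == i.-1 :> nat) && (s == j :> nat))%:R.
Proof.
case/andP=> [/andP[i0 le_ij] lt_jn]; rewrite inE => /existsP[c /eqP ->].
have n1 : n.-1.+1 = n by rewrite prednK // (leq_ltn_trans _ lt_jn).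
exists c => r s; rewrite !mxE -!(val_eqE _ (inord _)) /= !inordK // n1 //.
by apply: leq_ltn_trans lt_jn; apply: leq_trans le_ij; apply: leq_pred.
Qed.

Lemma rootsub_unitri (F : finFieldType) (n i j : nat) :
  posroot n i j -> rootsub F n i j \subset unitri F n.
Proof.
move=> ij; apply/subsetP=> g /(rootsubP ij)[c Hg]; apply/unitriP=> r s le_sr.
rewrite Hg; case: (r =P i.-1 :> nat) => [Er|_]; last by rewrite mulr0 addr0.
case: (s =P j :> nat) => [Es|_]; last by rewrite /= ?andbF mulr0 addr0.
have /andP[/andP[i0 le_ij] _] := ij.
by move: le_sr; rewrite Er Es leqNgt (leq_trans _ le_ij) // prednK.
Qed.

Lemma unitri_mul0 (F : finFieldType) (n : nat) (x y : {'GL_n[F]})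
    (i j k : 'I_n.-1.+1) :
  x \in unitri F n -> y \in unitri F n -> ~~ (i <= k <= j)%N ->
  GLval x i k * GLval y k j = 0.
Proof.
move=> /unitriP Hx /unitriP Hy; rewrite negb_and -!ltnNge => /orP[lt|lt].
  by rewrite Hx 1?ltnW // -val_eqE /= gtn_eqF // mul0r.
by rewrite Hy 1?ltnW // -val_eqE /= gtn_eqF // mulr0.
Qed.

Lemma unitri_rootgen (F : finFieldType) (n : nat) :
  unitri F n = rootgen F n (fun _ _ => true).
Proof.
apply/eqP; rewrite eqEsubset andbC.
apply/andP; split.
  by apply/rootgen_subP=> s t st _; apply: rootsub_unitri.
apply/subsetP=> g; set G := rootgen _ _ _.
pose supp (x : {'GL_n[F]}) :=
  [set p : 'I_n.-1.+1 * 'I_n.-1.+1 | (p.1 < p.2)%N && (GLval x p.1 p.2 != 0)].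
have [m] := ubnP #|supp g|; elim: m g => // m IHm g lt_m Ug.
have [s0|[[p1 p2] Hp0]] := set_0Vmem (supp g).
  suff -> : g = 1%g by apply: group1.
  apply: val_inj; apply/matrixP=> i j; have /unitriP Hg := Ug.
  rewrite [RHS]mxE; have [/Hg//|lt_ij] := leqP j i.
  rewrite -val_eqE /= ltn_eqF //; apply/eqP/negPn/negP=> nz.
  by have := in_set0 (i, j); rewrite -s0 inE /= lt_ij nz.
case: (@arg_maxnP _ (p1, p2) (mem (supp g)) (fun p => p.2) Hp0).
move=> [i k] /= Hik maxk; have := Hik; rewrite inE /= => /andP[lt_ik nz].
have rowk l : GLval g k l = (k == l)%:R.
  have /unitriP Hg := Ug; have [/Hg//|lt_kl] := leqP l k.
  rewrite -val_eqE /= ltn_eqF //; apply/eqP/negPn/negP=> nz'.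
  have := maxk (k, l); rewrite inE /= lt_kl nz' => /(_ isT).
  by rewrite leqNgt lt_kl.
pose c := GLval g i k.
have st : posroot n i.+1 k.
  have k_gt0 : (0 < k)%N := leq_ltn_trans (leq0n i) lt_ik.
  have n_gt0 : (0 < n)%N.
    by apply: leq_trans (leq_pred n); apply: leq_trans k_gt0 _; rewrite -ltnS.
  by rewrite /posroot /= lt_ik -[X in (_ < X)%N](prednK n_gt0) ltn_ord.
have unitE d : (1%:M + d *: delta_mx i k : 'M[F]_n.-1.+1) \in unitmx.
  rewrite unitmxE -det_tr det_trig.
    rewrite big1 ?unitr1 // => l _; rewrite !mxE eqxx.
    case: eqP => [->|]; last by rewrite /= ?andbF mulr0 addr0.
    by rewrite -val_eqE /= ltn_eqF // mulr0 addr0.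
  apply/is_trig_mxP=> a b lt_ab; rewrite !mxE -!val_eqE /= (gtn_eqF lt_ab) add0r.
  case: eqP => [Eb|]; last by rewrite /= ?andbF mulr0.
  case: eqP => [Ea|]; last by rewrite /= ?andbF mulr0.
  by move: lt_ab; rewrite Ea Eb ltnNge (ltnW lt_ik).
pose e : {'GL_n[F]} := FinRing.Unit (unitE (- c)).
have Xe : e \in rootsub F n i.+1 k.
  by rewrite inE; apply/existsP; exists (- c); rewrite /= !inord_val.
have Ge : e \in G.
  by have /rootgen_subP/(_ _ _ st isT)/subsetP/(_ e Xe) := subxx G.
have Ue : e \in unitri F n by apply: (subsetP (rootsub_unitri F st)).
rewrite -(groupMl _ Ge); apply: IHm; last by apply: groupM.
have Heg r s : GLval (e * g)%g r s = GLval g r s - c * ((r == i) && (s == k))%:R.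
  rewrite GL_MxE /= mulmxDl mul1mx -scalemxAl mxE [X in _ + X]mxE.
  congr (_ + _); rewrite mulNr; congr (- (c * _)).
  rewrite mxE (bigD1 k) //= big1 ?addr0 => [|l nlk].
    by rewrite mxE eqxx andbT rowk -natrM mulnb [k == s]eq_sym.
  by rewrite mxE (negPf nlk) andbF mul0r.
rewrite ltnS in lt_m; apply: leq_trans lt_m; apply: proper_card.
apply/properP; split.
  apply/subsetP=> [[r s]]; rewrite !inE /= => /andP[-> ]; rewrite Heg /=.
  case: andP => [[/eqP-> /eqP->]|_]; last by rewrite /= ?andbF mulr0 subr0.
  by rewrite mulr1 subrr eqxx.
by exists (i, k) => //; rewrite inE /= Heg !eqxx mulr1 subrr eqxx andbF.
Qed.

Lemma Rblock_sdprod (F : finFieldType) (n a b : nat) :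
  (Rblock F n a b ><| Ublock F n a b)%g = unitri F n.
Proof.
pose blk (r c : 'I_n.-1.+1) := (a <= r.+1)%N && (c <= b)%N.
pose M := [set g in unitri F n | [forall r : 'I_n.-1.+1, forall c : 'I_n.-1.+1,
  (r < c)%N && ~~ blk r c ==> (GLval g r c == 0)]].
pose N := [set g in unitri F n | [forall r : 'I_n.-1.+1, forall c : 'I_n.-1.+1,
  (r < c)%N && blk r c ==> (GLval g r c == 0)]].
have MP g : reflect (g \in unitri F n /\
    forall r c : 'I_n.-1.+1, (r < c)%N -> ~~ blk r c -> GLval g r c = 0) (g \in M).
  apply: (iffP setIdP) => [] [Ug H]; split=> //.
    move=> r c lt nb; have /forallP/(_ r)/forallP/(_ c) := H.
    by rewrite lt nb => /eqP.
  apply/forallP=> r; apply/forallP=> c; apply/implyP=> /andP[lt nb].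
  by rewrite H.
have NP g : reflect (g \in unitri F n /\
    forall r c : 'I_n.-1.+1, (r < c)%N -> blk r c -> GLval g r c = 0) (g \in N).
  apply: (iffP setIdP) => [] [Ug H]; split=> //.
    move=> r c lt nb; have /forallP/(_ r)/forallP/(_ c) := H.
    by rewrite lt nb => /eqP.
  apply/forallP=> r; apply/forallP=> c; apply/implyP=> /andP[lt nb].
  by rewrite H.
have offd (r c : 'I_n.-1.+1) : (r < c)%N -> (r == c)%:R = 0 :> F.
  by move=> lt; rewrite -val_eqE /= ltn_eqF.
have gM : group_set M.
  apply/group_setP; split.
    by apply/MP; split=> [|r c lt _]; rewrite ?group1 // GL_1E mxE offd.
  move=> x y /MP[Ux Hx] /MP[Uy Hy]; apply/MP; split=> [|r c lt nb].
    exact: groupM.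
  rewrite GL_MxE mxE big1 // => k _.
  have [/andP[le1 le2]|/(unitri_mul0 Ux Uy)//] := boolP (r <= k <= c)%N.
  have [nb1|b1] := boolP (blk r k); last first.
    have [E|ne] := eqVneq k r; first by rewrite E Hy ?mulr0.
    by rewrite Hx ?mul0r // ltn_neqAle le1 andbT eq_sym val_eqE.
  have lt_kc : (k < c)%N.
    rewrite ltn_neqAle le2 andbT; apply/eqP=> /val_inj E.
    by move: nb; rewrite -E nb1.
  rewrite Hy ?mulr0 //; apply: contra nb => /andP[_ cb].
  by case/andP: nb1 => ar _; rewrite /blk ar.
have gN : group_set N.
  apply/group_setP; split.
    by apply/NP; split=> [|r c lt _]; rewrite ?group1 // GL_1E mxE offd.
  move=> x y /NP[Ux Hx] /NP[Uy Hy]; apply/NP; split=> [|r c lt nb].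
    exact: groupM.
  rewrite GL_MxE mxE big1 // => k _.
  have [/andP[le1 le2]|/(unitri_mul0 Ux Uy)//] := boolP (r <= k <= c)%N.
  have /andP[ar cb] := nb.
  have [E|ne] := eqVneq k r; first by rewrite E Hy ?mulr0.
  rewrite Hx ?mul0r //; first by rewrite ltn_neqAle le1 andbT eq_sym val_eqE.
  by rewrite /blk ar (leq_trans le2).
have nN : unitri F n \subset 'N(N).
  apply/subsetP=> g Ug; rewrite inE; apply/subsetP=> _ /imsetP[x /NP[Ux Hx] ->].
  apply/NP; split=> [|r c lt nb]; first exact: groupJ.
  have Ugi : g^-1%g \in unitri F n by rewrite groupV.
  have Uxg : (x * g)%g \in unitri F n by apply: groupM.
  have /andP[ar cb] := nb.
  suff -> : GLval (x ^ g)%g r c = GLval (g^-1 * g)%g r c.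
    by rewrite mulVg GL_1E mxE offd.
  have mulE (u v : {'GL_n[F]}) s t :
      GLval (u * v)%g s t = \sum_k GLval u s k * GLval v k t.
    by rewrite GL_MxE mxE.
  rewrite /conjg !(mulE _^-1%g); apply: eq_bigr => k _.
  have [/andP[le1 le2]|nk] := boolP (r <= k <= c)%N; last first.
    by rewrite !unitri_mul0.
  congr (_ * _); rewrite mulE (bigD1 k) //= big1 => [|l nlk].
    by have /unitriP-> := Ux; rewrite // eqxx mul1r addr0.
  have [/andP[le3 le4]|/(unitri_mul0 Ux Ug)//] := boolP (k <= l <= c)%N.
  rewrite Hx ?mul0r //; first by rewrite ltn_neqAle le3 andbT eq_sym val_eqE.
  by rewrite /blk (leq_trans ar) //= (leq_trans le4).
have sUM : Ublock F n a b \subset Group gM.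
  apply/rootgen_subP=> s t st /andP[sa tb]; apply/subsetP=> g Xg.
  apply/MP; split=> [|r c lt nb]; first exact: (subsetP (rootsub_unitri F st)).
  have [d ->] := rootsubP st Xg; rewrite offd // add0r.
  case: eqP => [Er|]; last by rewrite /= ?andbF mulr0.
  case: eqP => [Ec|]; last by rewrite /= ?andbF mulr0.
  case/negP: nb; rewrite /blk Er Ec tb andbT prednK //.
  by case/andP: st => /andP[].
have sRN : Rblock F n a b \subset Group gN.
  rewrite gen_subG; apply: class_support_sub_norm; last exact: nN.
  apply/bigcupsP=> s _; apply/bigcupsP=> t /andP[st nsub].
  apply/subsetP=> g Xg.
  apply/NP; split=> [|r c lt nb]; first exact: (subsetP (rootsub_unitri F st)).
  have [d ->] := rootsubP st Xg; rewrite offd // add0r.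
  case: eqP => [Er|]; last by rewrite /= ?andbF mulr0.
  case: eqP => [Ec|]; last by rewrite /= ?andbF mulr0.
  case/negP: nsub; have /rootgen_subP := subxx (Ublock F n a b); apply=> //.
  move: nb; rewrite /blk Er Ec prednK //.
  by case/andP: st => /andP[].
have tiRU : Rblock F n a b :&: Ublock F n a b = 1%g.
  apply/trivgP/subsetP=> g /setIP[/(subsetP sRN)/NP[Ug HN] /(subsetP sUM)/MP[_ HM]].
  rewrite inE; apply/eqP; apply: val_inj; apply/matrixP=> r c; rewrite [RHS]mxE.
  have [le|lt] := leqP c r; first by have /unitriP-> := Ug.
  by rewrite offd //; have [/HN->|/HM->] := boolP (blk r c).
have sUU : Ublock F n a b \subset unitri F n.
  by apply/rootgen_subP=> s t st _; apply: rootsub_unitri.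
have nRU : unitri F n \subset 'N(Rblock F n a b).
  by apply: norms_gen; apply: class_support_norm.
have sRU : Rblock F n a b \subset unitri F n.
  by apply: subset_trans sRN _; apply/subsetP=> g /NP[].
rewrite sdprodE //; last exact: subset_trans nRU.
apply/eqP; rewrite eqEsubset mul_subG //=.
rewrite -norm_joinEr; last exact: subset_trans nRU.
rewrite {1}unitri_rootgen //; apply/rootgen_subP=> s t st _.
have [sub|nsub] := boolP (rootsub F n s t \subset Ublock F n a b).
  exact: subset_trans (joing_subr _ _).
apply: subset_trans (joing_subl _ _); apply: sub_gen.
apply: subset_trans (sub_class_support _ _).
have /andP[/andP[_ le_st] lt_tn] := st.
apply: subset_trans (bigcup_sup (Ordinal (leq_ltn_trans le_st lt_tn)) _) => //.
by apply: (bigcup_sup (Ordinal lt_tn)); rewrite /= st.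
Qed.

Definition infl (F : finFieldType) (n a b : nat) (phi : 'CF(Ublock F n a b)) :
    'CF(unitri F n) :=
  cfSdprod (Rblock_sdprod F n a b) phi.

(* For a linear character this set of conditions describes the elements of
   Irr(V/[V, V])^*, V = V_alpha with alpha = (i, j): linear characters of V are
   the characters of V/[V, V] inflated to V. *)
Definition lin_star (F : finFieldType) (n i j : nat)
    (lambda : 'CF(Vgrp F n i j)) : Prop :=
  [/\ lambda \is a linear_char,
      'Res[rootsub F n i j] lambda != 1 &
      forall s t : nat, posroot n s t -> rootsub F n s t \subset Vgrp F n i j ->
        (s, t) <> (i, j) -> 'Res[rootsub F n s t] lambda = 1].

Definition elementary (F : finFieldType) (n i j : nat)
    (psi : 'CF(unitri F n)) : Prop :=
  posroot n i j /\
  exists2 lambda : 'CF(Vgrp F n i j),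
    lin_star lambda & psi = 'Ind[unitri F n] lambda.

Definition almost_faithful (gT : finGroupType) (G : {group gT})
    (chi : 'CF(G)) : Prop :=
  'Res['Z(G)] chi != chi 1%g *: 1.

Definition mu (n : nat) : nat :=
  if odd n then (n./2 ^ 2)%N else (n./2 * n./2.-1)%N.

Definition nchar (F : finFieldType) (n e : nat) : nat :=
  #|[set k : Iirr (unitri F n) | 'chi_k 1%g == (#|F| ^ e)%:R]|.

(* Main.v *)
Require Import Defs.
From mathcomp Require Import all_boot all_order all_algebra all_fingroup.
From mathcomp Require Import all_solvable all_field all_character.
From mathcomp Require Import zify ring.

(** In terms of matrix entries counted from 0, let X be the root subgroup of the
    corner entry (0, n - 1), which is the centre of U, and consider a character of
    degree q^(mu n - 1).

    If it is not trivial on X, restrict it to the last column without its corner.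
    Row operations from row 0 change its values by nontrivial scalars, so it vanishes
    there away from 1 and the restriction is a multiple of the regular character. The
    vectors fixed by this subgroup then afford an irreducible character of the group V
    of the highest root, from which the given one is induced (Hecke_ind); on these
    vectors V acts by an additive character of the corner entry and through the
    central block of size n - 2. This is case (i), in almost_faithful_irr.

    If it is trivial on X but on neither of the root subgroups of the entries
    (0, n - 2) and (1, n - 1), the same argument with the last two columns gives case (ii), in
    second_layer_irr. The inducing subgroup has one more additive coordinate, the
    entry (0, 1), which accounts for the q constituents of the product of two
    elementary characters.

    Otherwise, up to the antidiagonal automorphism, it is trivial on the two top
    entries of the last column. The degree of a character with a fixed vector under A
    is at most the index of any P normalizing A with P / A abelian
    (irr_deg_le_index); a suitable P has index at most q^(mu n - 2)
    (corner_col_bound).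

    In the first two cases the parameters are determined by the character
    (semidirect_Hecke_inj), which gives the count. *)

Set Implicit Arguments.
Unset Strict Implicit.
Unset Printing Implicit Defensive.

Import Order.TTheory GRing.Theory Num.Theory.
Local Open Scope ring_scope.

(** * Restriction to a subgroup and fixed vectors *)

Section Characters.

Import GroupScope.
Local Open Scope ring_scope.

Variable gT : finGroupType.
Implicit Types G H S A Z N P R : {group gT}.

Lemma lin_char_conjK G (xi : 'CF(G)) :
  xi \is a linear_char -> {in G, forall x, (xi x)^* * xi x = 1}.
Proof.
move=> Lxi x Gx; rewrite -(lin_charV_conj Lxi) // -lin_charM ?groupV //.
by rewrite mulVg lin_char1.
Qed.

Lemma constt_Res_lift G S A (chi : 'CF(G)) (a : Iirr A) :
    chi \is a character -> S \subset G -> A \subset S ->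
    a \in irr_constt ('Res[A] chi) ->
  exists2 t : Iirr S, t \in irr_constt ('Res[S] chi)
                    & a \in irr_constt ('Res[A] 'chi_t).
Proof.
move=> Nchi sSG sAS; rewrite irr_consttE => nz_a.
have [t /andP[St At]|no_t] :=
    pickP [pred t : Iirr S | (t \in irr_constt ('Res[S] chi))
                           && (a \in irr_constt ('Res[A] 'chi_t))].
  by exists t.
case/eqP: nz_a; rewrite -(cfResRes _ sAS sSG) ['Res[S] chi]cfun_sum_constt.
rewrite linear_sum cfdot_suml big1 // => t St; rewrite linearZ cfdotZl.
have /negbT := no_t t; rewrite /= St /= irr_consttE negbK => /eqP ->.
by rewrite mulr0.
Qed.

(** By Clifford's theorem a constituent trivial on a normal subgroup forces all of
    them to be: kernels can be lifted from the subgroup S to the whole group. *)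
Lemma constt_normal_cfker G S N (t : Iirr S) (k : Iirr G) :
    N <| G -> N \subset S -> S \subset G -> t \in irr_constt ('Res[S] 'chi_k) ->
  N \subset cfker 'chi_t -> N \subset cfker 'chi_k.
Proof.
move=> nNG sNS sSG kt kerN; apply: constt0_Res_cfker => //.
rewrite -(cfResRes _ sNS sSG).
apply: (constt_Res_trans _ kt); first by rewrite cfRes_char ?irr_char.
have -> : 'Res[N] 'chi_t = 'chi_t 1%g *: 'chi_0.
  apply/cfun_inP=> x Nx; rewrite irr0 cfunE cfun1E Nx mulr1 cfResE //.
  by apply: cfker1; apply: (subsetP kerN).
by rewrite irr_consttE cfdotZl cfnorm_irr mulr1 irr1_neq0.
Qed.

Lemma sub_cfker_constt_Res G S (N : {set gT}) (k : Iirr G) (t : Iirr S) :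
    N \subset S -> N \subset cfker 'chi_k -> t \in irr_constt ('Res[S] 'chi_k) ->
  N \subset cfker 'chi_t.
Proof.
move=> sNS kerN kt; apply: subset_trans (cfker_constt _ kt).
  exact: sub_cfker_Res.
by rewrite cfRes_char ?irr_char.
Qed.

Lemma irr_ratio_cfker G (t : Iirr G) x (c : algC) :
  x \in cfker 'chi_t -> 'chi_t x = 'chi_t 1%g * c -> c = 1.
Proof.
rewrite cfkerEirr inE => /eqP->; rewrite -{1}['chi_t 1%g]mulr1.
by move/(mulfI (irr1_neq0 t)).
Qed.

Lemma commg_cfcenter G N (k : Iirr G) :
  N \subset G -> [~: N, G] \subset cfker 'chi_k -> N \subset 'Z('chi_k)%CF.
Proof.
move=> sNG cNG; have nK : G \subset 'N(cfker 'chi_k) by apply: cfker_norm.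
have nKN := subset_trans sNG nK.
have : (N / cfker 'chi_k \subset 'Z('chi_k)%CF / cfker 'chi_k)%g.
  rewrite cfcenter_eq_center subsetI quotientS //.
  by rewrite quotient_cents2.
by rewrite (quotientSGK nKN (normal_sub (cfker_center_normal _))).
Qed.

Lemma cfcenterM G (k : Iirr G) x z :
    x \in G -> z \in 'Z('chi_k)%CF ->
  'chi_k (x * z)%g * 'chi_k 1%g = 'chi_k x * 'chi_k z.
Proof.
move=> Gx; rewrite -irrRepr cfcenter_repr => /setIdP[Gz /is_scalar_mxP[c rz]].
rewrite !cfunE !(group1, groupM, Gx, Gz) // !mulr1n repr_mxM // rz repr_mx1.
rewrite mul_mx_scalar mxtraceZ !mxtrace_scalar -[c *+ _]mulr_natr.
by rewrite mulrA [c * _]mulrC.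
Qed.

(** The element x is conjugate to a product of x and a conjugate of z, and z acts
    as a scalar different from 1, so the value at x equals itself times that scalar. *)
Lemma irr_vanish G (k : Iirr G) x y z :
    x \in G -> y \in G -> z \in 'Z('chi_k)%CF -> (y * x = x * y * z)%g ->
  'chi_k z != 'chi_k 1%g -> 'chi_k x = 0.
Proof.
move=> Gx Gy Zz yx; have Gz := subsetP (cfcenter_sub _) _ Zz.
apply: contraNeq => nz_x; have nzI := mulfI nz_x; apply/eqP/nzI.
have Zzy : (z ^ y^-1)%g \in 'Z('chi_k)%CF.
  by rewrite memJ_norm // (subsetP (normal_norm (cfcenter_normal _))) ?groupV.
rewrite -(cfunJ 'chi_k z (groupVr Gy)) -cfcenterM //; congr (_ * _).
rewrite -[RHS](cfunJ 'chi_k x (groupVr Gy)); congr ('chi_k _).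
by rewrite /conjg invgK !mulgA yx.
Qed.

Lemma Res_cfdot_avg G A (chi : 'CF(G)) :
  A \subset G -> '['Res[A] chi, 1] = #|A|%:R^-1 * \sum_(x in A) chi x.
Proof.
move=> sAG; rewrite cfdotE; congr (_ * _); apply: eq_bigr => x Ax.
by rewrite cfResE // cfun1E Ax conjC1 mulr1.
Qed.

(** The vectors fixed by A carry a representation of the abelian group P / A, hence
    contain a linear constituent of P; Frobenius reciprocity bounds the degree. *)
Lemma irr_deg_le_index G P A (k : Iirr G) :
    A <| P -> P \subset G -> [~: P, P] \subset A ->
    (0 : Iirr A) \in irr_constt ('Res[A] 'chi_k) ->
  'chi_k 1%g <= #|G : P|%:R.
Proof.
move=> nAP sPG cPP k0; have sAP := normal_sub nAP.
have [t kt t0] := constt_Res_lift (irr_char k) sPG sAP k0.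
have /(subset_trans cPP) := constt0_Res_cfker nAP t0.
rewrite -lin_irr_der1 => lin_t; rewrite -constt_Ind_Res in kt.
have := char1_ge_constt (cfInd_char G (irr_char t)) kt.
by rewrite cfInd1 // (lin_char1 lin_t) mulr1.
Qed.

(** If the restriction of an irreducible character to A is concentrated on a
    subgroup Z of its kernel, then it is a multiple of the permutation character
    of A on A / Z, so the vectors fixed by A form a space whose dimension is the
    degree divided by #|A : Z|. When #|G : S| does not exceed #|A : Z|, comparing
    degrees shows that this space affords an irreducible character of S, from
    which the given character is induced. *)
Section Hecke.

Variables (G S A Z : {group gT}) (k : Iirr G).
Hypotheses (sSG : S \subset G) (nAS : A <| S) (sZA : Z \subset A).
Hypotheses (leGS : (#|G : S| <= #|A : Z|)%N).
Hypotheses (kerZ : Z \subset cfker 'chi_k).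
Hypotheses (vanA : forall x, x \in A -> x \notin Z -> 'chi_k x = 0).

Let sAS : A \subset S := normal_sub nAS.
Let sAG : A \subset G := subset_trans sAS sSG.

Lemma Hecke_cfdot : '['Res[A] 'chi_k, 1] * #|A : Z|%:R = 'chi_k 1%g.
Proof.
rewrite Res_cfdot_avg // (big_setID Z) /= (setIidPr sZA).
rewrite [X in _ + X]big1 ?addr0 => [|x /setDP[Ax nZx]]; last exact: vanA.
rewrite (eq_bigr (fun=> 'chi_k 1%g)) => [|x Zx]; last first.
  exact/cfker1/(subsetP kerZ).
rewrite sumr_const -(Lagrange sZA) natrM invfM -mulr_natr.
have nzZ : #|Z|%:R != 0 :> algC by rewrite pnatr_eq0 -lt0n cardG_gt0.
have nzi : #|A : Z|%:R != 0 :> algC by rewrite pnatr_eq0 -lt0n indexg_gt0.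
by field; rewrite nzZ nzi.
Qed.

Lemma Hecke_constt_le (t : Iirr S) :
    t \in irr_constt ('Res[S] 'chi_k) ->
  'chi_k 1%g <= #|A : Z|%:R * 'chi_t 1%g.
Proof.
rewrite -constt_Ind_Res => kt.
apply: le_trans (char1_ge_constt (cfInd_char G (irr_char t)) kt) _.
by rewrite cfInd1 // ler_wpM2r ?char1_ge0 ?irr_char // ler_nat.
Qed.

Lemma Res_ker_cfdot (t : Iirr S) :
  A \subset cfker 'chi_t -> '['Res[A] 'chi_t, 1] = 'chi_t 1%g.
Proof.
move=> kerA; have -> : 'Res[A] 'chi_t = 'chi_t 1%g *: 1.
  apply/cfun_inP=> x Ax; rewrite cfunE cfun1E Ax mulr1 cfResE //.
  by apply: cfker1; apply: (subsetP kerA).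
by rewrite cfdotZl cfnorm1 mulr1.
Qed.

(** Both inequalities between 'chi_k 1 and #|G : S| * 'chi_t 1 hold: one by Frobenius
    reciprocity, the other because 'chi_t contributes 'chi_t 1 fixed vectors. *)
Lemma Hecke_ind (t : Iirr S) :
    A \subset cfker 'chi_t -> t \in irr_constt ('Res[S] 'chi_k) ->
  'chi_k = 'Ind 'chi_t.
Proof.
move=> kerA kt; have Nk : 'Res[S] 'chi_k \is a character.
  by rewrite cfRes_char ?irr_char.
have [r Nr def_r] := constt_charP _ Nk kt.
have le_t : 'chi_t 1%g * #|A : Z|%:R <= 'chi_k 1%g.
  rewrite -Hecke_cfdot ler_wpM2r ?ler0n // -(cfResRes _ sAS sSG) def_r.
  rewrite linearD cfdotDl Res_ker_cfdot // lerDl -irr0 natr_ge0 //.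
  by rewrite Cnat_cfdot_char_irr // cfRes_char.
have kt' := kt; rewrite -constt_Ind_Res in kt'.
have [s Ns def_s] := constt_charP _ (cfInd_char G (irr_char t)) kt'.
suff /eqP s0 : s == 0 by rewrite def_s s0 addr0.
rewrite -char1_eq0 // eq_le char1_ge0 // andbT.
rewrite -(lerD2l ('chi_k 1%g)) addr0.
have <- : 'Ind[G] 'chi_t 1%g = 'chi_k 1%g + s 1%g by rewrite def_s cfunE.
apply: le_trans le_t; rewrite cfInd1 // mulrC.
by rewrite ler_wpM2l ?char1_ge0 ?irr_char // ler_nat.
Qed.

Lemma Hecke_exists :
  exists2 t : Iirr S, A \subset cfker 'chi_t & t \in irr_constt ('Res[S] 'chi_k).
Proof.
have k0 : (0 : Iirr A) \in irr_constt ('Res[A] 'chi_k).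
  rewrite irr_consttE irr0; apply: contraNneq (irr1_neq0 k) => d0.
  by rewrite -Hecke_cfdot d0 mul0r.
have [t kt t0] := constt_Res_lift (irr_char k) sSG sAS k0.
by exists t; rewrite ?constt0_Res_cfker.
Qed.

(** Two different constituents trivial on A would need more fixed vectors than there
    are. *)
Lemma Hecke_unique (s t : Iirr S) :
    A \subset cfker 'chi_s -> s \in irr_constt ('Res[S] 'chi_k) ->
    A \subset cfker 'chi_t -> t \in irr_constt ('Res[S] 'chi_k) ->
  s = t.
Proof.
move=> kerAs ks kerAt kt; apply/eqP/idPn=> neq_st.
have Nk : 'Res[S] 'chi_k \is a character by rewrite cfRes_char ?irr_char.
have [r Nr def_r] := constt_charP _ Nk ks.
have rt : t \in irr_constt r.
  move: kt; rewrite !irr_consttE def_r cfdotDl cfdot_irr (negPf neq_st).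
  by rewrite add0r.
have [r' Nr' def_r'] := constt_charP _ Nr rt.
have : '['Res[A] 'chi_k, 1] >= 'chi_s 1%g + 'chi_t 1%g.
  rewrite -(cfResRes _ sAS sSG) def_r def_r' 2!linearD 2!cfdotDl.
  rewrite !Res_ker_cfdot // lerD2l lerDl -irr0 natr_ge0 //.
  by rewrite Cnat_cfdot_char_irr // cfRes_char.
have : '['Res[A] 'chi_k, 1] <= 'chi_s 1%g.
  have pos : 0 < #|A : Z|%:R :> algC by rewrite ltr0n indexg_gt0.
  by rewrite -(ler_pM2r pos) Hecke_cfdot mulrC Hecke_constt_le.
move=> le1 le2; have := le_trans le2 le1.
by rewrite gerDl (lt_geF (irr1_gt0 t)).
Qed.

End Hecke.

Lemma constt_mul G (i j k : Iirr G) (phi psi : 'CF(G)) :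
    phi \is a character -> psi \is a character ->
    i \in irr_constt phi -> j \in irr_constt psi -> 'chi_k = 'chi_i * 'chi_j ->
  k \in irr_constt (phi * psi).
Proof.
move=> Nphi Npsi /(constt_charP _ Nphi)[f Nf ->] /(constt_charP _ Npsi)[g Ng ->] def_k.
apply/constt_charP; first by rewrite rpredM ?rpredD ?irr_char.
exists ('chi_i * g + f * ('chi_j + g)); first by rewrite !(rpredD, rpredM) ?irr_char.
by rewrite def_k mulrDl mulrDr addrA.
Qed.

Lemma constt_Res_Ind_self G S (i : Iirr S) :
  S \subset G -> i \in irr_constt ('Res[S] ('Ind[G] 'chi_i)).
Proof.
move=> sSG; rewrite irr_consttE cfdot_Res_l cfnorm_eq0.
rewrite -char1_eq0 ?cfInd_char ?irr_char // cfInd1 //.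
by rewrite mulf_neq0 ?irr1_neq0 ?pnatr_eq0 -?lt0n ?indexg_gt0.
Qed.

End Characters.

(** * Induction in a semidirect product *)

(** The irreducible characters of U = R ><| H that are induced from a subgroup S
    containing H, by passing to the vectors fixed by A. Modulo A the group
    S :&: R is central in S, so that the fixed vectors afford a linear character
    L a of S, trivial on H, times an irreducible character of H. The predicate
    good singles out the characters for which this works; good_intro and good_elim
    say that this happens exactly when the linear character of S :&: R on the fixed
    vectors is that of some L a with a in J. *)
Section SemidirectHecke.
Import GroupScope.
Local Open Scope ring_scope.

Variables (gT : finGroupType) (U R H S A Z : {group gT}).
Hypotheses (defU : R ><| H = U) (sHS : H \subset S) (sSU : S \subset U).

Let defS : (S :&: R)%G ><| H = S.
Proof. by rewrite (sdprod_modr defU sHS) (setIidPl sSU). Qed.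

Lemma Res_cfSdprod (phi : 'CF(H)) :
  'Res[S] (cfSdprod defU phi) = cfSdprod defS phi.
Proof.
apply/cfun_inP=> _ /(mem_sdprod defS)[x [y [/setIP[Sx Rx] Hy -> _]]].
have Sy := subsetP sHS y Hy; rewrite cfResE ?groupM // (cfSdprodE defU) //.
by rewrite (cfSdprodE defS) // inE Sx.
Qed.

Lemma irr_trivial_on_kernel (t : Iirr S) :
  (S :&: R)%G \subset cfker 'chi_t ->
  exists j : Iirr H, 'chi_t = 'Res[S] (cfSdprod defU 'chi_j).
Proof.
move=> kerP; have def_t : 'chi_t = cfSdprod defS ('Res[H] 'chi_t).
  apply/cfun_inP=> _ /(mem_sdprod defS)[x [y [Px Hy -> _]]].
  rewrite cfSdprodE // cfResE // cfkerMl //; exact: (subsetP kerP).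
have : 'Res[H] 'chi_t \in irr H by rewrite -(cfSdprod_irr defS) -def_t mem_irr.
by case/irrP=> j def_j; exists j; rewrite Res_cfSdprod -def_j -def_t.
Qed.

(** Dividing by xi makes the character trivial on S :&: R, hence inflated from H. *)
Lemma twist_irr (xi : 'CF(S)) (t : Iirr S) :
    xi \is a linear_char ->
    {in S :&: R, forall x, 'chi_t x = 'chi_t 1%g * xi x} ->
  exists j : Iirr H, 'chi_t = xi * 'Res[S] (cfSdprod defU 'chi_j).
Proof.
move=> Lxi t_xi; have Lxi' : xi^*%CF \is a linear_char by rewrite cfConjC_lin_char.
have /irrP[s def_s] := mul_lin_irr Lxi' (mem_irr t).
have [|j def_j] := @irr_trivial_on_kernel s.
  apply/subsetP=> x Px; have /setIP[Sx _] := Px.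
  rewrite cfkerEirr inE -def_s !cfunE t_xi // mulrCA lin_char_conjK //.
  by rewrite (lin_char1 Lxi) rmorph1 mul1r mulr1.
exists j; rewrite -def_j -def_s; apply/cfun_inP=> x Sx.
by rewrite !cfunE mulrA [xi x * _]mulrC lin_char_conjK ?mul1r.
Qed.

Hypotheses (nAS : A <| S) (sAR : A \subset R) (sZA : Z \subset A).
Hypotheses (comPS : [~: S :&: R, S] \subset A).
Hypotheses (leUS : (#|U : S| <= #|A : Z|)%N).

Variables (good : pred (Iirr U)).
Hypothesis good_ker : forall k, good k -> Z \subset cfker 'chi_k.
Hypothesis good_van : forall k x,
  good k -> x \in A -> x \notin Z -> 'chi_k x = 0.

Variables (I : finType) (J : {set I}) (L : I -> 'CF(S)).
Hypothesis linL : forall a, L a \is a linear_char.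
Hypothesis kerLA : forall a, A \subset cfker (L a).
Hypothesis kerLH : forall a, H \subset cfker (L a).
Hypothesis injL : injective L.
Hypothesis good_intro : forall a k (t : Iirr S),
  a \in J -> t \in irr_constt ('Res[S] 'chi_k) ->
  {in S :&: R, forall x, 'chi_t x = 'chi_t 1%g * L a x} -> good k.
Hypothesis good_elim : forall k (t : Iirr S) (rho : 'CF(S :&: R)),
  good k -> t \in irr_constt ('Res[S] 'chi_k) -> rho \is a linear_char ->
  A \subset cfker 'chi_t ->
  {in S :&: R, forall x, 'chi_t x = 'chi_t 1%g * rho x} ->
  exists2 a, a \in J & {in S :&: R, rho =1 L a}.

Let tau a (phi : 'CF(H)) := L a * 'Res[S] (cfSdprod defU phi).

Lemma Ind_tau a phi : 'Ind[U] (tau a phi) = 'Ind[U] (L a) * cfSdprod defU phi.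
Proof. exact: cfIndM. Qed.

Lemma tau_irr a (j : Iirr H) : tau a 'chi_j \in irr S.
Proof. by rewrite mul_lin_irr // Res_cfSdprod cfSdprod_irr mem_irr. Qed.

Lemma tau_on_kernel a j :
  {in S :&: R, forall x, tau a 'chi_j x = tau a 'chi_j 1%g * L a x}.
Proof.
move=> x /setIP[Sx Rx]; rewrite !cfunE (lin_char1 (linL a)) mul1r mulrC.
congr (_ * _); rewrite !cfResE // -[x]mulg1 cfSdprodE // cfSdprod1 //.
Qed.

Lemma tau_kerA a j : A \subset cfker (tau a 'chi_j).
Proof.
have Ntau : tau a 'chi_j \is a character by rewrite irrWchar ?tau_irr.
apply/subsetP=> x Ax; rewrite cfkerEchar // inE.
have Sx : x \in S := subsetP (normal_sub nAS) x Ax.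
have Px : x \in S :&: R by rewrite inE Sx (subsetP sAR).
rewrite Sx tau_on_kernel // (cfker1 (subsetP (kerLA a) x Ax)).
by rewrite (lin_char1 (linL a)) mulr1 eqxx.
Qed.

Lemma tau_ind k a j : tau a 'chi_j = 'chi_k -> a \in J -> forall l : Iirr U,
  k \in irr_constt ('Res[S] 'chi_l) -> good l /\ 'chi_l = 'Ind[U] (tau a 'chi_j).
Proof.
move=> def_k Ja l kl; have gl : good l.
  by apply: good_intro Ja kl _ => x Px; rewrite -def_k tau_on_kernel.
split=> //; rewrite def_k.
apply: (Hecke_ind sSU nAS sZA leUS (good_ker gl)) => //; last first.
  by rewrite -def_k tau_kerA.
by move=> x; apply: good_van.
Qed.

Lemma semidirect_Hecke_irr a (j : Iirr H) : a \in J ->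
  exists2 k, good k & 'chi_k = 'Ind[U] (L a) * cfSdprod defU 'chi_j.
Proof.
move=> Ja; have /irrP[t def_t] := tau_irr a j.
have [l tl] := constt_cfInd_irr t sSU.
have [|gl def_l] := tau_ind def_t Ja (l := l); first by rewrite -constt_Ind_Res.
by exists l; rewrite // -Ind_tau.
Qed.

(** The constituent trivial on A has S :&: R in its centre, so it is a multiple of a
    linear character there; good_elim extends the latter to S. *)
Lemma semidirect_Hecke_form k : good k ->
  exists a j, a \in J /\ 'chi_k = 'Ind[U] (L a) * cfSdprod defU 'chi_j.
Proof.
move=> gk; have van := fun x => @good_van k x gk.
have [t kerA kt] := Hecke_exists sSU nAS sZA (good_ker gk) van.
have sPS : S :&: R \subset S := subsetIl _ _.
have sPZ : S :&: R \subset 'Z('chi_t)%CF.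
  exact: (@commg_cfcenter _ _ [group of S :&: R]) (subset_trans comPS kerA).
have [xi Lxi def_xi] := cfcenter_Res 'chi_t.
have t_xi : {in S :&: R, forall x, 'chi_t x = 'chi_t 1%g * 'Res[S :&: R] xi x}.
  move=> x Px; rewrite cfResE //; have /= := congr1 (fun f : 'CF(_) => f x) def_xi.
  by rewrite cfunE cfResE ?cfcenter_sub // (subsetP sPZ).
have [a Ja rho_a] := good_elim gk kt (cfRes_lin_char _ Lxi) kerA t_xi.
have [|j def_t] := @twist_irr (L a) t (linL a).
  by move=> x Px; rewrite t_xi // rho_a.
exists a, j; split=> //; rewrite -Ind_tau /tau -def_t.
exact: (Hecke_ind sSU nAS sZA leUS (good_ker gk) van).
Qed.

(** The constituent of the restriction to S that is trivial on A is unique, and its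
    restrictions to H and to S :&: R determine the two parameters. *)
Lemma semidirect_Hecke_inj k a b (i j : Iirr H) : a \in J -> b \in J ->
  'chi_k = 'Ind[U] (L a) * cfSdprod defU 'chi_i ->
  'chi_k = 'Ind[U] (L b) * cfSdprod defU 'chi_j -> a = b /\ i = j.
Proof.
move=> Ja Jb; rewrite -!Ind_tau => k_ai k_bj.
have /irrP[s def_s] := tau_irr a i; have /irrP[t def_t] := tau_irr b j.
have ks : s \in irr_constt ('Res[S] 'chi_k).
  by rewrite -constt_Ind_Res -def_s -k_ai constt_irr inE.
have kt : t \in irr_constt ('Res[S] 'chi_k).
  by rewrite -constt_Ind_Res -def_t -k_bj constt_irr inE.
have [gk _] := tau_ind def_s Ja ks.
have van := fun x => @good_van k x gk.
have eq_tau : tau a 'chi_i = tau b 'chi_j.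
  rewrite def_s def_t; congr 'chi_ _.
  apply: (Hecke_unique sSU nAS sZA leUS (good_ker gk) van) => //.
    by rewrite -def_s tau_kerA.
  by rewrite -def_t tau_kerA.
have valH c l y : y \in H -> tau c 'chi_l y = 'chi_l y.
  move=> Hy; have Sy := subsetP sHS y Hy.
  rewrite cfunE (cfker1 (subsetP (kerLH c) y Hy)) (lin_char1 (linL c)) mul1r cfResE //.
  by rewrite cfSdprodEr.
have eq_ij : i = j.
  by apply/irr_inj/cfun_inP=> y Hy; rewrite -(valH a) // eq_tau valH.
split=> //; apply/injL/cfun_inP=> _ /(mem_sdprod defS)[x [y [Px Hy -> _]]].
have /setIP[Sx _] := Px.
have kLH c : L c (x * y)%g = L c x by rewrite cfkerMr // (subsetP (kerLH c)).
apply: (mulfI (irr1_neq0 i)).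
have t1 c l : tau c 'chi_l 1%g = 'chi_l 1%g by rewrite valH ?group1.
by rewrite !kLH -{1}(t1 a) -tau_on_kernel // eq_tau tau_on_kernel // t1 eq_ij.
Qed.

Lemma semidirect_Hecke_card (d : nat) :
  #|[set k | good k & 'chi_k 1%g == (#|U : S| * d)%:R]| =
  (#|J| * #|[set j : Iirr H | 'chi_j 1%g == d%:R]|)%N.
Proof.
set D := [set j : Iirr H | _]; rewrite -cardsX.
pose f (p : I * Iirr H) := cfIirr ('Ind[U] (L p.1) * cfSdprod defU 'chi_p.2).
have fE p : p.1 \in J -> good (f p) /\
    'chi_(f p) = 'Ind[U] (L p.1) * cfSdprod defU 'chi_p.2.
  move=> Jp; have [k gk def_k] := semidirect_Hecke_irr p.2 Jp.
  have -> : f p = k by rewrite /f -def_k; apply: irr_inj; rewrite cfIirrE ?mem_irr.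
  by [].
have deg a j : ('Ind[U] (L a) * cfSdprod defU 'chi_j) 1%g =
    #|U : S|%:R * 'chi_j 1%g.
  by rewrite cfunE cfInd1 // (lin_char1 (linL a)) mulr1 cfSdprod1.
have nzi : #|U : S|%:R != 0 :> algC by rewrite pnatr_eq0 -lt0n indexg_gt0.
have <- : f @: setX J D = [set k | good k & 'chi_k 1%g == (#|U : S| * d)%:R].
  apply/setP=> k; apply/imsetP/idP=> [[[a j] /setXP[Ja Dj] ->]|].
    have [gk def_k] := @fE (a, j) Ja; rewrite inE gk def_k deg natrM /=.
    by move: Dj; rewrite inE => /eqP ->.
  rewrite inE => /andP[gk dk]; have [a [j [Ja def_k]]] := semidirect_Hecke_form gk.
  exists (a, j); last first.
    by apply: irr_inj; have [_ ->] := @fE (a, j) Ja; rewrite def_k.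
  rewrite inE /= Ja inE; move: dk; rewrite def_k deg natrM.
  by move/eqP/(mulfI nzi)->; rewrite eqxx.
rewrite card_in_imset // => -[a i] [b j] /setXP[Ja _] /setXP[Jb _] eq_f.
have [[_ E1] [_ E2]] := (@fE (a, i) Ja, @fE (b, j) Jb).
rewrite -eq_f in E2.
by have [/= -> ->] := semidirect_Hecke_inj Ja Jb E1 E2.
Qed.

End SemidirectHecke.

(** * Pattern groups *)

Section PatternGroups.
Import GroupScope.
Local Open Scope ring_scope.

Variables (F : finFieldType) (n : nat).
Local Notation I := 'I_n.-1.+1.
Local Notation M := 'M[F]_n.-1.+1.
Local Notation GL := ({'GL_n[F]} : finGroupType).
Local Notation U := (unitri F n).
Implicit Types (D E : rel nat) (X Y : M) (g h x y : GL) (r c k : I).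

Definition supported D X := forall r c, X r c != 0 -> (r < c)%N && D r c.

(** The pattern group of D; it is a group when D is transitive along increasing
    indices, which is the case D = E = D0 of comp_rel. *)
Definition pattern D : {set GL} :=
  [set g : GL | [forall r : I, forall c : I,
     ((GLval g - 1%:M) r c != 0) ==> ((r < c)%N && D r c)]].

Lemma patternP D g : reflect (supported D (GLval g - 1%:M)) (g \in pattern D).
Proof.
rewrite inE; apply: (iffP forallP) => [H r c nz | H r].
  by have /forallP/(_ c)/implyP := H r; apply.
by apply/forallP=> c; apply/implyP; apply: H.
Qed.

(** What makes a product of strictly upper triangular matrices supported on D and on E
    supported on D0. *)
Definition comp_rel D E D0 := forall r k c : nat,
  (r < k)%N -> (k < c)%N -> (c <= n.-1)%N -> D r k -> E k c -> D0 r c.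

Lemma supported_mul D E D0 X Y :
  comp_rel D E D0 -> supported D X -> supported E Y -> supported D0 (X *m Y).
Proof.
move=> cDE sX sY r c; rewrite mxE => nz.
have [k nzk] : exists k, X r k * Y k c != 0.
  apply/existsP; apply: contraR nz; rewrite negb_exists => /forallP z.
  by rewrite big1 // => k _; apply/eqP; have := z k; rewrite negbK.
have [nzX nzY] : X r k != 0 /\ Y k c != 0.
  by split; apply: contraNneq nzk => ->; rewrite ?mul0r ?mulr0.
have /andP[lt1 D1] := sX _ _ nzX; have /andP[lt2 D2] := sY _ _ nzY.
by rewrite (ltn_trans lt1 lt2) /= (cDE r k c) // -ltnS.
Qed.

Lemma supported_add D X Y :
  supported D X -> supported D Y -> supported D (X + Y).
Proof.
move=> sX sY r c; rewrite mxE; have [/eqP|/sX//] := boolP (X r c == 0).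
by move->; rewrite add0r; apply: sY.
Qed.

Lemma supported_opp D X : supported D X -> supported D (- X).
Proof. by move=> sX r c; rewrite mxE oppr_eq0; apply: sX. Qed.

Lemma supported_sub D E X :
    (forall r c : nat, (r < c)%N -> (c <= n.-1)%N -> D r c -> E r c) ->
  supported D X -> supported E X.
Proof.
move=> sDE sX r c /sX/andP[lt_rc Drc].
by rewrite lt_rc /= sDE // -ltnS.
Qed.

Lemma supported_mull D D0 g X :
    comp_rel D D0 D0 -> g \in pattern D -> supported D0 X ->
  supported D0 (GLval g *m X).
Proof.
move=> cD /patternP Dg sX; rewrite -(subrK 1%:M (GLval g)) mulmxDl mul1mx.
by apply: supported_add => //; apply: supported_mul Dg sX.
Qed.

Lemma supported_mulr D D0 g X :
    comp_rel D0 D D0 -> g \in pattern D -> supported D0 X ->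
  supported D0 (X *m GLval g).
Proof.
move=> cD /patternP Dg sX; rewrite -(subrK 1%:M (GLval g)) mulmxDr mulmx1.
by apply: supported_add => //; apply: supported_mul sX Dg.
Qed.

Lemma pattern_group_set D : comp_rel D D D -> group_set (pattern D).
Proof.
move=> cD; apply/group_setP; split.
  by apply/patternP=> r c; rewrite GL_1E subrr mxE eqxx.
move=> g h Dg Dh; apply/patternP; rewrite GL_MxE.
have -> : GLval g *m GLval h - 1%:M =
    (GLval g - 1%:M) *m GLval h + (GLval h - 1%:M).
  by rewrite mulmxBl mul1mx addrA subrK.
apply: supported_add; last exact/patternP.
by apply: supported_mulr cD Dh _; apply/patternP.
Qed.

Definition pattern_group D (cD : comp_rel D D D) := Group (pattern_group_set cD).

Lemma pattern_sub D E :
    (forall r c : nat, (r < c)%N -> (c <= n.-1)%N -> D r c -> E r c) ->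
  pattern D \subset pattern E.
Proof.
move=> sDE; apply/subsetP=> g /patternP Dg.
by apply/patternP; apply: supported_sub Dg.
Qed.

Lemma unitri_pattern : U = pattern (fun _ _ => true).
Proof.
apply/setP=> g; apply/unitriP/patternP => [Ug r c | Dg r c le_cr].
  rewrite andbT ltnNge; apply: contra => le_cr.
  by rewrite !mxE Ug // subrr.
apply/eqP; rewrite -subr_eq0; apply: contraTT le_cr => nz.
by have := Dg r c; rewrite !mxE => /(_ nz)/andP[]; rewrite -ltnNge.
Qed.

Lemma pattern_unitri D : pattern D \subset U.
Proof. by rewrite unitri_pattern pattern_sub. Qed.

Lemma patternE D g :
  (g \in pattern D) <->
  (g \in U /\ forall r c, (r < c)%N -> ~~ D r c -> GLval g r c = 0).
Proof.
split=> [Dg | [Ug zg]].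
  split=> [|r c lt_rc]; first exact: (subsetP (pattern_unitri D)).
  apply: contraNeq => nz; have /patternP/(_ r c) := Dg.
  by rewrite !mxE -val_eqE /= (ltn_eqF lt_rc) subr0 => /(_ nz)/andP[].
apply/patternP=> r c; rewrite !mxE => nz.
case: (ltnP r c) nz => [lt_rc | le_cr]; last first.
  by have /unitriP-> := Ug; rewrite // subrr eqxx.
by rewrite -val_eqE /= (ltn_eqF lt_rc) subr0; apply: contraR => /zg->.
Qed.

(** Conjugation multiplies x - 1 by elements of the larger group on both sides. *)
Lemma pattern_norm D D0 :
    comp_rel D D D -> comp_rel D D0 D0 -> comp_rel D0 D D0 ->
  pattern D \subset 'N(pattern D0).
Proof.
move=> cD cl cr; apply/subsetP=> g Dg; rewrite inE.
apply/subsetP=> _ /imsetP[x Dx ->]; apply/patternP.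
have Dg' : g^-1%g \in pattern_group cD by rewrite groupV.
have -> : GLval (x ^ g)%g - 1%:M = GLval g^-1%g *m (GLval x - 1%:M) *m GLval g.
  by rewrite mulmxBr mulmx1 mulmxBl -!GL_MxE mulVg GL_1E /conjg mulgA.
by apply: supported_mulr cr Dg _; apply: supported_mull cl Dg' _; apply/patternP.
Qed.

(** The matrix [~ x, y] - 1 is the product of x^-1, y^-1 and the additive commutator of
    x - 1 and y - 1. *)
Lemma pattern_commg D E D0 (c0 : comp_rel D0 D0 D0) :
    comp_rel D D D -> comp_rel E E E ->
    comp_rel D E D0 -> comp_rel E D D0 ->
    comp_rel D D0 D0 -> comp_rel E D0 D0 ->
  [~: pattern D, pattern E] \subset pattern D0.
Proof.
move=> cD cE cDE cED cD0 cE0; rewrite -[pattern D0]/(gval (pattern_group c0)).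
rewrite gen_subG; apply/subsetP=> _ /imset2P[x y Dx Ey ->]; apply/patternP.
have Dx' : x^-1%g \in pattern_group cD by rewrite groupV.
have Ey' : y^-1%g \in pattern_group cE by rewrite groupV.
have -> : GLval [~ x, y]%g - 1%:M =
  GLval x^-1%g *m (GLval y^-1%g *m
    ((GLval x - 1%:M) *m (GLval y - 1%:M) - (GLval y - 1%:M) *m (GLval x - 1%:M))).
  have -> : (GLval x - 1%:M) *m (GLval y - 1%:M)
      - (GLval y - 1%:M) *m (GLval x - 1%:M)
      = GLval (x * y)%g - GLval (y * x)%g.
    rewrite !GL_MxE !mulmxBl !mulmxBr !mulmx1 !mul1mx.
    set a := _ *m _; set b := _ *m _; set u := GLval x; set v := GLval y.
    rewrite !opprB !addrA; apply/matrixP=> i j; rewrite !mxE; ring.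
  rewrite !mulmxBr -!GL_MxE mulKg mulVg GL_1E; congr (GLval _ - _).
apply: (supported_mull cD0 Dx'); apply: (supported_mull cE0 Ey').
apply: supported_add; first by apply: supported_mul cDE _ _; apply/patternP.
by apply/supported_opp; apply: supported_mul cED _ _; apply/patternP.
Qed.

Lemma pattern_normal D D0 (cD : comp_rel D D D) (c0 : comp_rel D0 D0 D0) :
    (forall r c : nat, (r < c)%N -> (c <= n.-1)%N -> D0 r c -> D r c) ->
    comp_rel D D0 D0 -> comp_rel D0 D D0 ->
  pattern_group c0 <| pattern_group cD.
Proof. by move=> sD0D cl cr; rewrite /normal pattern_sub // pattern_norm. Qed.

Lemma unitri_unitmx X : unitri_mx X -> X \in unitmx.
Proof.
move=> /unitri_mxP UX; rewrite unitmxE -det_tr det_trig.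
  by rewrite big1 ?unitr1 // => r _; rewrite mxE UX // eqxx.
by apply/is_trig_mxP=> r c lt_rc; rewrite mxE UX 1?ltnW // -val_eqE /= gtn_eqF.
Qed.

Definition toGL X : GL := insubd (1%g : GL) X.

Lemma toGLK X : unitri_mx X -> GLval (toGL X) = X.
Proof. by move=> UX; rewrite -[LHS]/(val _) insubdK //; apply: unitri_unitmx. Qed.

Lemma supported_unitri D X : supported D X -> unitri_mx (1%:M + X).
Proof.
move=> sX; apply/unitri_mxP=> r c le_cr; rewrite !mxE.
have [/eqP|/sX/andP[]] := boolP (X r c == 0); first by move->; rewrite addr0.
by rewrite ltnNge le_cr.
Qed.

Lemma supported_toGL D X :
  supported D X -> GLval (toGL (1%:M + X)) = 1%:M + X.
Proof. by move=> sX; rewrite toGLK ?(supported_unitri sX). Qed.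

Lemma toGL_pattern D X : supported D X -> toGL (1%:M + X) \in pattern D.
Proof.
by move=> sX; apply/patternP; rewrite (supported_toGL sX) addrC addKr.
Qed.

Definition cells D : {set I * I} := [set p : I * I | (p.1 < p.2)%N && D p.1 p.2].

Lemma card_pattern D : #|pattern D| = (#|F| ^ #|cells D|)%N.
Proof.
pose f g : {ffun I * I -> F} := [ffun p => (GLval g - 1%:M) p.1 p.2].
have injf : injective f.
  move=> g h /ffunP eq_f; apply: val_inj; apply/matrixP=> r c.
  have := eq_f (r, c); rewrite !ffunE /= !mxE.
  by move/addIr.
rewrite -cardsT -(card_pffun_on 0) -(card_imset _ injf); apply: eq_card => u.
apply/imsetP/pffun_onP => [[g /patternP Dg ->]|[/subsetP su _]].
  split=> [|? _]; last by rewrite inE.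
  apply/subsetP=> -[r c]; rewrite !inE /= ffunE /= => nz; exact: Dg.
pose X : M := \matrix_(r, c) u (r, c).
have sX : supported D X.
  by move=> r c; rewrite mxE => nz; have := su (r, c); rewrite !inE /=; apply.
exists (toGL (1%:M + X)); first exact: toGL_pattern.
by apply/ffunP=> -[r c]; rewrite ffunE (supported_toGL sX) addrC addKr mxE.
Qed.

End PatternGroups.

(** * Root elements *)

Section RootElements.
Import GroupScope.
Local Open Scope ring_scope.

Variables (F : finFieldType) (n : nat).
Local Notation I := 'I_n.-1.+1.
Local Notation M := 'M[F]_n.-1.+1.
Local Notation GL := ({'GL_n[F]} : finGroupType).
Local Notation U := (unitri F n).
Implicit Types (D E : rel nat) (X Y : M) (g h x y : GL) (r c k i j : I) (s t : F).

Lemma mul_delta_mxE i k X r c :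
  (delta_mx i k *m X) r c = (r == i)%:R * X k c.
Proof.
rewrite mxE (bigD1 k) //= big1 ?addr0 => [|l /negPf nlk]; first last.
  by rewrite mxE nlk andbF mul0r.
by rewrite mxE eqxx andbT.
Qed.

Lemma mul_mx_deltaE i j X r c :
  (X *m delta_mx i j) r c = X r i * (c == j)%:R.
Proof.
rewrite mxE (bigD1 i) //= big1 ?addr0 => [|l /negPf nli]; first last.
  by rewrite mxE nli mulr0.
by rewrite mxE eqxx.
Qed.

Definition rootelt r c t : GL := toGL (1%:M + t *: delta_mx r c).

Lemma supported_delta D r c t :
  (r < c)%N -> D r c -> supported D (t *: delta_mx r c : M).
Proof.
move=> lt_rc Drc a b; rewrite !mxE; have [->|] := eqVneq a r; last first.
  by rewrite mulr0 eqxx.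
have [->|] := eqVneq b c; last by rewrite mulr0 eqxx.
by rewrite lt_rc Drc.
Qed.

Lemma rootelt_pattern D r c t :
  (r < c)%N -> D r c -> rootelt r c t \in pattern F n D.
Proof. by move=> lt_rc Drc; apply/toGL_pattern/supported_delta. Qed.

Lemma rooteltE r c t :
  (r < c)%N -> GLval (rootelt r c t) = 1%:M + t *: delta_mx r c.
Proof.
move=> lt_rc; apply: (@supported_toGL _ _ (fun _ _ => true)).
exact: supported_delta.
Qed.

Lemma rootelt_unitri r c t : (r < c)%N -> rootelt r c t \in U.
Proof. by move=> lt_rc; rewrite unitri_pattern rootelt_pattern. Qed.

Lemma rooteltD r c s t : (r < c)%N ->
  rootelt r c (s + t) = (rootelt r c s * rootelt r c t)%g.
Proof.
move=> lt_rc; apply: val_inj; rewrite -[LHS]/(GLval _) -[RHS]/(GLval _).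
rewrite GL_MxE !rooteltE // mulmxDl !mulmxDr !mul1mx mulmx1 -scalemxAl -scalemxAr.
rewrite mul_delta_mx_0 ?scaler0 ?addr0; last by rewrite -val_eqE /= gtn_eqF.
by rewrite scalerDl addrAC addrA.
Qed.

Lemma rootelt_mull i k t g :
    (i < k)%N -> (forall c, GLval g k c = (k == c)%:R) ->
  GLval (rootelt i k t * g)%g = GLval g + t *: delta_mx i k.
Proof.
move=> lt_ik row_k; rewrite GL_MxE rooteltE // mulmxDl mul1mx -scalemxAl.
congr (_ + _ *: _); apply/matrixP=> r c.
by rewrite mul_delta_mxE row_k mxE -natrM mulnb [k == c]eq_sym.
Qed.

Lemma rootsub_rootelt r c g : (r < c)%N ->
  g \in rootsub F n r.+1 c -> g = rootelt r c (GLval g r c).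
Proof.
move=> lt_rc; rewrite inE /= !inord_val => /existsP[t /eqP def_g].
apply: val_inj; rewrite -[LHS]/(GLval _) -[RHS]/(GLval _) rooteltE // def_g.
by rewrite !mxE -val_eqE /= (ltn_eqF lt_rc) add0r !eqxx mulr1.
Qed.

Lemma rootelt_rootsub r c t : (r < c)%N -> rootelt r c t \in rootsub F n r.+1 c.
Proof.
by move=> lt_rc; rewrite inE /= !inord_val rooteltE //; apply/existsP; exists t.
Qed.

(** By Gaussian elimination, one root element at a time. *)
Lemma pattern_rootgen D : comp_rel n D D D ->
  rootgen F n (fun a b => D a.-1 b) = pattern F n D.
Proof.
move=> cD; apply/eqP; rewrite eqEsubset; apply/andP; split.
  rewrite -[pattern _ _ D]/(gval (pattern_group F cD)).
  apply/rootgen_subP=> a b st Dst; apply/subsetP=> g Xg; apply/patternP=> r c.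
  have [d def_g] := rootsubP st Xg; rewrite !mxE def_g addrAC subrr add0r.
  case: andP => [[/eqP-> /eqP->] _ | _]; last by rewrite mulr0 eqxx.
  by rewrite Dst andbT; case/andP: st => /andP[a_gt0 le_st] _; rewrite prednK.
apply/subsetP=> g.
have [m] := ubnP #|[set p : I * I | (GLval g - 1%:M) p.1 p.2 != 0]|.
elim: m g => // m IHm g; rewrite ltnS => le_m Dg.
have [s0|[[a b] /[!inE]/= nz_ab]] :=
    set_0Vmem [set p : I * I | (GLval g - 1%:M) p.1 p.2 != 0].
  suff -> : g = 1%g by apply: group1.
  apply: val_inj; rewrite -[LHS]/(GLval _) -[RHS]/(GLval _) GL_1E.
  apply/eqP; rewrite -subr_eq0; apply/eqP/matrixP=> r c; apply/eqP.
  have := in_set0 (r, c); rewrite -s0 inE /= => /negbFE/eqP->.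
  by rewrite mxE.
(* For a nonzero entry (i, k) of g - 1 with k maximal, row k of g is that of the
   identity, so that a row operation clears this entry and no other one. *)
pose supp := [pred p : I * I | (GLval g - 1%:M) p.1 p.2 != 0].
case: (@arg_maxnP _ (a, b) supp (fun p => p.2) nz_ab) => [[i k]] /= nz_ik max_k.
have /andP[lt_ik Dik] := (patternP _ _ Dg) _ _ nz_ik.
have row_k c : GLval g k c = (k == c)%:R.
  apply/eqP; rewrite -subr_eq0; apply/negPn/negP => nz.
  have nz_kc : (GLval g - 1%:M) k c != 0 by rewrite !mxE.
  have /andP[lt_kc _] := (patternP _ _ Dg) _ _ nz_kc.
  by have := max_k (k, c) nz_kc; rewrite /= leqNgt lt_kc.
pose e := rootelt i k (- (GLval g - 1%:M) i k).
have eg := rootelt_mull (- (GLval g - 1%:M) i k) lt_ik row_k; rewrite -/e in eg.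
have De : e \in rootgen F n (fun a b => D a.-1 b).
  have st : posroot n i.+1 k by rewrite /posroot; have := ltn_ord k; lia.
  have /rootgen_subP/(_ _ _ st Dik)/subsetP :=
    subxx (rootgen F n (fun a b => D a.-1 b)).
  by apply; apply: rootelt_rootsub.
rewrite -(groupMl _ De); apply: IHm; last first.
  by apply: (groupM (G := pattern_group F cD)) => //; apply: rootelt_pattern.
apply: leq_trans le_m; apply: proper_card; apply/properP; split.
  apply/subsetP=> -[r c]; rewrite !inE eg !mxE /=.
  case: andP => [[/eqP-> /eqP->] _|_]; last by rewrite mulr0 addr0.
  by move: nz_ik; rewrite !mxE.
exists (i, k); rewrite !inE ?eg // !mxE /= !eqxx mulr1.
by rewrite addrAC subrr eqxx.
Qed.

End RootElements.

(** * Linear characters and matrix entries *)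

Section LinearCharacters.
Import GroupScope.
Local Open Scope ring_scope.

Lemma lin_char_of_morph (gT : finGroupType) (G : {group gT}) (h : gT -> algC) :
    h 1%g = 1 -> {in G &, forall x y, h (x * y)%g = h x * h y} ->
  exists2 xi : 'CF(G), xi \is a linear_char & {in G, xi =1 h}.
Proof.
move=> h1 hM; pose r x : 'M[algC]_1 := (h x)%:M.
have rP : mx_repr G r.
  by split=> [|x y Gx Gy]; rewrite /r ?h1 // hM // scalar_mxM.
exists (cfRepr (MxRepresentation rP)).
  by rewrite qualifE /= cfRepr_char cfRepr1 eqxx.
by move=> x Gx; rewrite cfunE Gx mulr1n mxtrace_scalar mulr1n.
Qed.

Variable F : finFieldType.
Local Notation addchar := (Iirr [set: F]).

Lemma addchar_lin (i : addchar) : 'chi_i \is a linear_char.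
Proof. exact/char_abelianP/FinRing.zmod_abelian. Qed.

Lemma addcharD (i : addchar) (s t : F) :
  'chi_i (s + t) = 'chi_i s * 'chi_i t :> algC.
Proof. by rewrite -lin_charM ?addchar_lin ?inE. Qed.

Lemma addchar0 (i : addchar) : 'chi_i (0 : F) = 1 :> algC.
Proof. exact: (lin_char1 (addchar_lin i)). Qed.

Lemma addchar_neq0 (i : addchar) (t : F) : 'chi_i t != 0 :> algC.
Proof. by rewrite (lin_char_neq0 (addchar_lin i)) ?inE. Qed.

Lemma card_addchar : #|{: addchar}| = #|F|.
Proof. by rewrite card_Iirr_abelian ?FinRing.zmod_abelian // cardsT. Qed.

Lemma addchar_exists (h : F -> algC) :
    h 0 = 1 -> (forall s t, h (s + t) = h s * h t) ->
  exists i : addchar, forall t, 'chi_i t = h t.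
Proof.
move=> h0 hD; have [|s t _ _|xi Lxi xi_h] := @lin_char_of_morph F [set: F]%G h.
- exact: h0.
- exact: hD.
have /irrP[i def_i] := lin_char_irr Lxi.
by exists i => t; rewrite -def_i xi_h ?inE.
Qed.

Lemma card_nontrivial_addchar : #|[set i : addchar | i != 0]| = (#|F| - 1)%N.
Proof.
rewrite -card_addchar -cardsT (cardsD1 0 setT) inE add1n subn1 /=.
by apply: eq_card => i; rewrite !inE andbT.
Qed.

Lemma addchar_inj (i j : addchar) :
  (forall t, 'chi_i t = 'chi_j t :> algC) -> i = j.
Proof. by move=> eq_ij; apply/irr_inj/cfun_inP=> t _. Qed.

Lemma addchar_nontrivial (i : addchar) :
  i != 0 -> exists t : F, 'chi_i t != 1 :> algC.
Proof.
move=> nz_i; apply/existsP; apply: contraR nz_i; rewrite negb_exists.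
move=> /forallP triv; apply/eqP/addchar_inj => t.
by have := triv t; rewrite negbK irr0 cfun1E inE => /eqP.
Qed.

End LinearCharacters.

Section Coordinates.
Import GroupScope.
Local Open Scope ring_scope.

Variables (F : finFieldType) (n : nat).
Local Notation I := 'I_n.-1.+1.
Local Notation M := 'M[F]_n.-1.+1.
Local Notation GL := ({'GL_n[F]} : finGroupType).
Local Notation U := (unitri F n).
Implicit Types (D E : rel nat) (X Y : M) (g h x y : GL) (r c k i j : I) (s t : F).

(** No product of two entries contributes to the entry (r, c), which is therefore
    additive. *)
Lemma pattern_coordM D r c :
    (r < c)%N ->
    (forall k : nat, (r < k)%N -> (k < c)%N -> D r k -> D k c -> False) ->
  {in pattern F n D &, forall g h,
    GLval (g * h)%g r c = GLval g r c + GLval h r c}.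
Proof.
move=> lt_rc noD g h /patternP Dg /patternP Dh; rewrite GL_MxE.
have -> : GLval g *m GLval h =
    (GLval g - 1%:M) *m (GLval h - 1%:M) + (GLval g + GLval h - 1%:M).
  rewrite mulmxBl !mulmxBr !mulmx1 mul1mx.
  by apply/matrixP=> a b; rewrite !mxE; ring.
have compD : comp_rel n D D (fun a b => (a != r :> nat) || (b != c :> nat)).
  move=> a k b lt1 lt2 _ D1 D2; rewrite -negb_and.
  apply/negP=> /andP[/eqP Ea /eqP Eb].
  by move: lt1 lt2 D1 D2; rewrite Ea Eb; apply: noD.
have zero : ((GLval g - 1%:M) *m (GLval h - 1%:M)) r c = 0.
  apply: contraTeq isT => nz; have := supported_mul compD Dg Dh nz.
  by rewrite !eqxx andbF.
by rewrite mxE zero add0r !mxE -val_eqE /= (ltn_eqF lt_rc) subr0.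
Qed.

Lemma GL1_offdiag r c : (r < c)%N -> GLval (1%g : GL) r c = 0.
Proof. by move=> lt_rc; rewrite GL_1E mxE -val_eqE /= (ltn_eqF lt_rc). Qed.

Lemma rootelt_coord r c (a b : I) t : (r < c)%N -> (a < b)%N ->
  GLval (rootelt r c t) a b = t * ((a == r) && (b == c))%:R.
Proof.
by move=> lt_rc lt_ab; rewrite rooteltE // !mxE -val_eqE /= (ltn_eqF lt_ab) add0r.
Qed.

Lemma rootelt0 r c : (r < c)%N -> rootelt r c 0 = 1%g :> GL.
Proof.
move=> lt_rc; apply: val_inj; rewrite -[LHS]/(GLval _) -[RHS]/(GLval _).
by rewrite rooteltE // scale0r addr0 GL_1E.
Qed.

Lemma rootelt_addchar (G : {group GL}) (xi : 'CF(G)) r c :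
    (r < c)%N -> (forall t, rootelt r c t \in G) -> xi \is a linear_char ->
  exists i : Iirr [set: F], forall t, xi (rootelt r c t) = 'chi_i t.
Proof.
move=> lt_rc Gx Lxi; have [||i def_i] := @addchar_exists F (xi \o rootelt r c).
- by rewrite /= rootelt0 // lin_char1.
- by move=> s t; rewrite /= rooteltD // lin_charM.
by exists i => t; rewrite def_i.
Qed.

(** When column i of x is trivial, the commutator of x with a root element at (i, j)
    is the identity with a multiple of row j of x - 1 added to row i. *)
Lemma irr_vanish_row (l : Iirr U) x i j D :
    (i < j)%N -> x \in U -> (forall a, GLval x a i = (a == i)%:R) ->
    (forall c, (j < c)%N -> GLval x j c != 0 -> D i c) ->
    pattern F n D \subset 'Z('chi_l)%CF ->
    (exists t, forall z, z \in pattern F n D ->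
       (forall c, (i < c)%N ->
          GLval z i c = (if (j < c)%N then t * GLval x j c else 0)) ->
       'chi_l z != 'chi_l 1%g) ->
  'chi_l x = 0.
Proof.
move=> lt_ij Ux col_i Dx sDZ [t nz_t].
pose Z : M := \matrix_(a, c)
  ((a == i)%:R * (t * (if (j < c)%N then GLval x j c else 0))).
have sZ : supported D Z.
  move=> a c; rewrite mxE; have [->|_] := eqVneq a i; last by rewrite mul0r eqxx.
  case: ltnP => [lt_jc|_]; last by rewrite !mulr0 eqxx.
  rewrite (ltn_trans lt_ij lt_jc) mul1r /= => nz; apply: Dx => //.
  by apply: contraNneq nz => ->; rewrite mulr0.
have row_j c : GLval x j c = (j == c)%:R + (if (j < c)%N then GLval x j c else 0).
  case: ltnP => [lt_jc|le_cj]; first by rewrite -val_eqE /= (ltn_eqF lt_jc) add0r.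
  by have /unitriP-> := Ux; rewrite // addr0.
pose z := toGL (1%:M + Z); have Dz : z \in pattern F n D := toGL_pattern sZ.
pose y := rootelt i j t; have Uy : y \in U := rootelt_unitri t lt_ij.
apply: (irr_vanish Ux Uy (subsetP sDZ z Dz)).
  apply: val_inj; rewrite -[LHS]/(GLval _) -[RHS]/(GLval _).
  rewrite !GL_MxE rooteltE // (supported_toGL sZ).
  have -> : GLval x *m (1%:M + t *: delta_mx i j) = GLval x + t *: delta_mx i j.
    rewrite mulmxDr mulmx1 -scalemxAr; congr (_ + _ *: _).
    by apply/matrixP=> a c; rewrite mul_mx_deltaE col_i mxE -natrM mulnb.
  have dZ : delta_mx i j *m Z = 0.
    apply/matrixP=> a c; rewrite mul_delta_mxE !mxE -[j == i]val_eqE /=.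
    by rewrite (gtn_eqF lt_ij) mul0r mulr0.
  have xZ : GLval x *m Z = Z.
    apply/matrixP=> a c; rewrite mxE (bigD1 i) //= big1 ?addr0 => [|b /negPf nbi].
      by rewrite !mxE col_i eqxx mul1r.
    by rewrite !mxE nbi mul0r mulr0.
  rewrite mulmxDr mulmx1 [in RHS]mulmxDl -[in RHS]scalemxAl dZ xZ scaler0 addr0.
  rewrite mulmxDl mul1mx -scalemxAl -addrA; congr (_ + _).
  apply/matrixP=> a c; rewrite mxE mul_delta_mxE row_j !mxE.
  by case: (a == i); rewrite ?mul0r ?mulr0 ?addr0 //= !mul1r mulrDr eq_sym.
apply: nz_t => // c lt_ic; rewrite (supported_toGL sZ) !mxE -val_eqE /=.
by rewrite (ltn_eqF lt_ic) add0r eqxx mul1r; case: ifP => //; rewrite mulr0.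
Qed.

End Coordinates.

(** * The subgroups attached to roots as pattern groups *)

Section PatternFacts.
Import GroupScope.
Local Open Scope ring_scope.

Variables (F : finFieldType) (n : nat).
Local Notation I := 'I_n.-1.+1.
Local Notation GL := ({'GL_n[F]} : finGroupType).
Local Notation U := (unitri F n).
Local Notation pattern := (pattern F n).
Implicit Types (D E : rel nat) (g h x y : GL) (r c : I) (s t : F).

Lemma pattern_eq D g h : g \in pattern D -> h \in pattern D ->
  (forall r c, (r < c)%N -> D r c -> GLval g r c = GLval h r c) -> g = h.
Proof.
move=> Dg Dh eq_gh; have [/patternE[Ug zg] /patternE[Uh zh]] := (Dg, Dh).
apply: val_inj; apply/matrixP=> r c; rewrite -!/(GLval _).
have [le_cr|lt_rc] := leqP c r.
  by have [/unitriP-> // /unitriP->] := (Ug, Uh).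
by have [/eq_gh->//|nDrc] := boolP (D r c); rewrite zg ?zh.
Qed.

Lemma patternI D E :
  pattern D :&: pattern E = pattern (fun a b => D a b && E a b).
Proof.
apply/setP=> g; rewrite inE; apply/andP/patternP.
  move=> [/patternP Dg /patternP Eg] r c nz.
  by have [/andP[-> ->] /andP[_ ->]] := (Dg _ _ nz, Eg _ _ nz).
by move=> H; split; apply/patternP=> r c /H /and3P[-> D1 D2]; rewrite ?D1 ?D2.
Qed.

Lemma index_pattern D E : comp_rel n D D D -> comp_rel n E E E ->
    (forall r c : nat, (r < c)%N -> (c <= n.-1)%N -> E r c -> D r c) ->
  #|pattern D : pattern E| = (#|F| ^ #|cells n (fun a b => D a b && ~~ E a b)|)%N.
Proof.
move=> cD cE sED; have sub : pattern_group F cE \subset pattern_group F cD.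
  exact: pattern_sub.
apply/eqP; rewrite -(eqn_pmul2l (cardG_gt0 (pattern_group F cE))) (Lagrange sub).
rewrite /= !card_pattern -expnD -(cardsID (cells n E) (cells n D)).
apply/eqP; congr (_ ^ (_ + _))%N; apply: eq_card => -[r c]; rewrite !inE /=.
  case: (ltnP r c) => //= lt_rc; have [Erc|_] := boolP (E r c); last by rewrite andbF.
  by rewrite (sED r c) // -ltnS.
by case: (ltnP r c); rewrite //= andbC.
Qed.

Lemma card_row_cells D r (lo hi : nat) : (lo < hi)%N -> (hi <= n.-1.+1)%N ->
    (forall a b : nat, (a < b)%N -> (b <= n.-1)%N ->
       D a b = (a == r :> nat) && (lo < b < hi)%N) ->
    (r <= lo)%N ->
  #|cells n D| = (hi - lo.+1)%N.
Proof.
move=> lt_lo le_hi DE le_r.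
have lt_hi (k : 'I_(hi - lo.+1)) : (k + lo.+1 < n.-1.+1)%N by have := ltn_ord k; lia.
pose f k : I * I := (r, Ordinal (lt_hi k)).
rewrite -[RHS]card_ord -(card_imset predT (f := f)) => [|k l [/eqP]]; last first.
  by rewrite eqn_add2r => /eqP/val_inj.
apply: eq_card => -[a b]; rewrite inE /=; apply/idP/imsetP.
  case/andP=> lt_ab; rewrite DE // -1?ltnS // => /and3P[/eqP Ea lt1 lt2].
  have lt_k : (b - lo.+1 < hi - lo.+1)%N by lia.
  exists (Ordinal lt_k) => //; congr (_, _); apply/val_inj => //=; lia.
case=> k _ [-> ->] /=; have lt_k := ltn_ord k; have lt_h := lt_hi k.
by rewrite DE ?eqxx /=; lia.
Qed.

Lemma card_col_cells D c (lo hi : nat) : (hi <= c)%N ->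
    (forall a b : nat, (a < b)%N -> (b <= n.-1)%N ->
       D a b = (b == c :> nat) && (lo <= a < hi)%N) ->
  #|cells n D| = (hi - lo)%N.
Proof.
move=> le_hi DE; have lt_c := ltn_ord c.
have lt_lo (k : 'I_(hi - lo)) : (k + lo < n.-1.+1)%N by have := ltn_ord k; lia.
pose f k : I * I := (Ordinal (lt_lo k), c).
rewrite -[RHS]card_ord -(card_imset predT (f := f)) => [|k l [/eqP]]; last first.
  by rewrite eqn_add2r => /eqP/val_inj.
apply: eq_card => -[a b]; rewrite inE /=; apply/idP/imsetP.
  case/andP=> lt_ab; rewrite DE // -1?ltnS // => /and3P[/eqP Eb lt1 lt2].
  have lt_k : (a - lo < hi - lo)%N by lia.
  exists (Ordinal lt_k) => //; congr (_, _); apply/val_inj => //=; lia.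
case=> k _ [-> ->] /=; have lt_k := ltn_ord k.
by rewrite DE ?eqxx /=; lia.
Qed.

Lemma card_cellsID D E : (#|cells n D| =
  #|cells n (fun a b => D a b && E a b)| + #|cells n (fun a b => D a b && ~~ E a b)|)%N.
Proof.
rewrite -(cardsID (cells n E)); congr (_ + _)%N; apply: eq_card => -[r c];
  by rewrite !inE /=; case: (ltnP r c); rewrite //= andbC.
Qed.

Lemma rootgen_pattern (P D : rel nat) : comp_rel n D D D ->
    (forall s t : nat, posroot n s t -> P s t = D s.-1 t) ->
  rootgen F n P = pattern D.
Proof.
move=> cD PD; rewrite -pattern_rootgen //; apply/eqP; rewrite eqEsubset.
apply/andP; split; apply/rootgen_subP=> s t st Pst.
  have /rootgen_subP := subxx (rootgen F n (fun a b => D a.-1 b)); apply=> //.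
  by rewrite -PD.
have /rootgen_subP := subxx (rootgen F n P); apply=> //.
by rewrite PD.
Qed.

(** The entries of the block of U_(a, b), in terms of matrix indices counted from 0. *)
Definition blk (a b : nat) : rel nat := fun k l => (a <= k.+1)%N && (l <= b)%N.

Lemma Ublock_pattern a b : Ublock F n a b = pattern (blk a b).
Proof.
apply: rootgen_pattern; first by rewrite /comp_rel /blk; lia.
by rewrite /posroot /blk; lia.
Qed.

Lemma rootsub_sub_pattern D (s t : nat) : posroot n s t ->
  (rootsub F n s t \subset pattern D) = D s.-1 t.
Proof.
case/andP=> /andP[s_gt0 le_st] lt_tn.
have lt_t : (t < n.-1.+1)%N by lia.
have lt_s : (s.-1 < n.-1.+1)%N by lia.
pose r := Ordinal lt_s; pose c := Ordinal lt_t.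
have lt_rc : (r < c)%N by rewrite /=; lia.
have -> : rootsub F n s t = rootsub F n r.+1 c by rewrite /= prednK.
apply/subsetP/idP => [/(_ _ (rootelt_rootsub 1 lt_rc)) /patternP/(_ r c) | Drc g].
  rewrite !mxE -!/(GLval _) rooteltE // !mxE !eqxx -val_eqE /= (ltn_eqF lt_rc).
  by rewrite add0r mulr1 subr0 oner_eq0 => /(_ isT)/andP[].
by move/(rootsub_rootelt lt_rc)->; apply: rootelt_pattern.
Qed.

Lemma Rblock_pattern a b :
  Rblock F n a b = pattern (fun k l => ~~ blk a b k l).
Proof.
set D := fun k l => _; have cD : comp_rel n D D D by rewrite /comp_rel /D /blk; lia.
apply/eqP; rewrite eqEsubset; apply/andP; split.
  rewrite -[pattern D]/(gval (pattern_group F cD)) gen_subG.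
  apply: class_support_sub_norm; last first.
    rewrite unitri_pattern; apply: pattern_norm => //; rewrite /comp_rel /D /blk; lia.
  apply/bigcupsP=> s _; apply/bigcupsP=> t /andP[st].
  by rewrite Ublock_pattern !rootsub_sub_pattern.
rewrite -(pattern_rootgen _ cD); apply/rootgen_subP=> s t st Dst.
apply: sub_gen; apply: subset_trans (sub_class_support _ _).
have /andP[/andP[_ le_st] lt_tn] := st.
apply: subset_trans (bigcup_sup (Ordinal (leq_ltn_trans le_st lt_tn)) _) => //.
apply: (bigcup_sup (Ordinal lt_tn)).
by rewrite /= st Ublock_pattern rootsub_sub_pattern.
Qed.

Definition armless (k l : nat) : rel nat := fun a b => ~~ ((a == k) && (b < l)%N).

Lemma armless_comp (r c : nat) : comp_rel n (armless r c) (armless r c) (armless r c).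
Proof. rewrite /comp_rel /armless; lia. Qed.

Lemma Vgrp_pattern r c : Vgrp F n r.+1 c = pattern (armless r c).
Proof.
apply: rootgen_pattern; first exact: armless_comp.
rewrite /posroot /armless /arm; lia.
Qed.

(** Row r of an element of V has no entry strictly between the diagonal and column c,
    so that the entry (r, c) is additive on V. *)
Lemma elementary_exists r c (i : Iirr [set: F]) : (r < c)%N -> i != 0 ->
  exists2 lambda : 'CF(Vgrp F n r.+1 c), lin_star lambda
    & {in Vgrp F n r.+1 c, forall g, lambda g = 'chi_i (GLval g r c)}.
Proof.
move=> lt_rc nz_i; have inV := Vgrp_pattern r c.
have [||la Lla laE] := @lin_char_of_morph _ [group of Vgrp F n r.+1 c]
    (fun g => 'chi_i (GLval g r c)).
- by rewrite GL1_offdiag ?addchar0.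
- move=> g h; rewrite /= inV => Vg Vh.
  rewrite (pattern_coordM lt_rc _ Vg Vh) ?addcharD //.
  by rewrite /armless => k; lia.
have Vx t : rootelt r c t \in Vgrp F n r.+1 c.
  by rewrite inV rootelt_pattern // /armless; lia.
exists la; last exact: laE.
have st : posroot n r.+1 c by rewrite /posroot; have := ltn_ord c; lia.
have sVr : rootsub F n r.+1 c \subset Vgrp F n r.+1 c.
  by rewrite inV rootsub_sub_pattern // /armless; lia.
split=> // [|s t st' sV ne].
  have [u nz_u] := addchar_nontrivial nz_i.
  apply: contra_neq nz_u => la1.
  have Xu := rootelt_rootsub u lt_rc.
  have := congr1 (fun f : 'CF(rootsub F n r.+1 c) => f (rootelt r c u)) la1.
  rewrite cfResE // laE // rootelt_coord //.
  by rewrite !eqxx mulr1 cfun1E Xu.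
apply/cfun_inP=> g Xg; rewrite cfResE //.
rewrite laE ?(subsetP sV) // cfun1E Xg; have [d ->] := rootsubP st' Xg.
rewrite -val_eqE /= (ltn_eqF lt_rc) add0r; case: eqP => [Er|_]; last first.
  by rewrite mulr0 addchar0.
case: eqP => [Ec|_]; last by rewrite mulr0 addchar0.
case: ne; congr (_, _) => //; case/andP: st' => /andP[s_gt0 _ _].
by rewrite Er prednK.
Qed.

End PatternFacts.

(** * Irreducible characters of U and pattern groups *)

Section PatternCharacters.
Import GroupScope.
Local Open Scope ring_scope.

Variables (F : finFieldType) (n : nat).
Local Notation I := 'I_n.-1.+1.
Local Notation GL := ({'GL_n[F]} : finGroupType).
Local Notation U := (unitri F n).
Local Notation pattern := (pattern F n).
Implicit Types (D E : rel nat) (g h x y : GL) (r c : I) (s t : F).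

Lemma pattern_false_sub (G : {group GL}) : pattern (fun _ _ => false) \subset G.
Proof.
have D0 : comp_rel n (fun _ _ => false) (fun _ _ => false) (fun _ _ => false) by [].
apply/subsetP=> g Dg; rewrite (@pattern_eq _ _ (fun _ _ => false) g 1%g) ?group1 //.
exact: (group1 (pattern_group F D0)).
Qed.

Lemma pattern_cfcenter (k : Iirr U) D D0 :
    comp_rel n D D D -> comp_rel n D0 D0 D0 ->
    comp_rel n (fun _ _ => true) D D0 -> comp_rel n D (fun _ _ => true) D0 ->
    comp_rel n (fun _ _ => true) D0 D0 ->
  pattern D0 \subset cfker 'chi_k -> pattern D \subset 'Z('chi_k)%CF.
Proof.
move=> cD c0 cTD cDT cT0 ker0.
apply: (@commg_cfcenter _ _ (pattern_group F cD)); first exact: pattern_unitri.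
apply: subset_trans ker0; rewrite /= unitri_pattern; apply: pattern_commg => //.
by move=> a b c lt1 lt2 le3 _; apply: cT0.
Qed.

Lemma pattern_normal_unitri D (cD : comp_rel n D D D) :
    comp_rel n (fun _ _ => true) D D -> comp_rel n D (fun _ _ => true) D ->
  pattern_group F cD <| unitri_group F n.
Proof.
move=> cl cr.
have cT : comp_rel n (fun _ _ => true) (fun _ _ => true) (fun _ _ => true).
  by [].
have := @pattern_normal F n _ _ cT cD (fun _ _ _ _ _ => isT) cl cr.
by rewrite /normal /= -unitri_pattern.
Qed.

Definition corner : rel nat := fun a b => (a == 0)%N && (b == n.-1).

Lemma corner_comp : comp_rel n corner corner corner.
Proof. rewrite /comp_rel /corner; lia. Qed.

Lemma corner_normal : pattern_group F corner_comp <| unitri_group F n.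
Proof. apply: pattern_normal_unitri; rewrite /comp_rel /corner; lia. Qed.

Definition corner_nontriv (k : Iirr U) := ~~ (pattern corner \subset cfker 'chi_k).

Lemma corner_cfcenter (k : Iirr U) : pattern corner \subset 'Z('chi_k)%CF.
Proof.
apply: (@pattern_cfcenter k corner (fun _ _ => false)) => //;
  try by rewrite /comp_rel /corner; lia.
exact: pattern_false_sub.
Qed.

Lemma cfkerPn (k : Iirr U) D : ~~ (pattern D \subset cfker 'chi_k) ->
  exists2 x, x \in pattern D & 'chi_k x != 'chi_k 1%g.
Proof.
case/subsetPn=> x Dx; rewrite cfkerEirr inE => ne; by exists x.
Qed.

(** The value on a root subgroup splits off, leaving an element with one entry less. *)
Lemma lin_char_clear_entry (G : {group GL}) (rho : 'CF(G)) r c (i : Iirr [set: F]) :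
    (r < c)%N -> rho \is a linear_char -> (forall t, rootelt r c t \in G) ->
    (forall t, rho (rootelt r c t) = 'chi_i t) ->
  {in G, forall g, rho g =
     rho (g * rootelt r c (- GLval g r c))%g * 'chi_i (GLval g r c)}.
Proof.
move=> lt_rc Lrho Gx rho_i g Gg; rewrite -rho_i -lin_charM ?groupM //.
by rewrite -mulgA -rooteltD // addNr rootelt0 // mulg1.
Qed.

(** An element of the pattern group of D is determined, modulo that of D0, by its entry
    at (r, c). *)
Lemma irr_eq_mod (k : Iirr U) D D0 r c z w : comp_rel n D D D -> (r < c)%N ->
    (forall l : nat, (r < l)%N -> (l < c)%N -> D r l -> D l c -> False) ->
    (forall a b : nat, (a < b)%N -> (b <= n.-1)%N -> D a b ->
       ((a == r) && (b == c)) || D0 a b) ->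
    pattern D0 \subset cfker 'chi_k ->
    z \in pattern D -> w \in pattern D -> GLval z r c = GLval w r c ->
  'chi_k z = 'chi_k w.
Proof.
move=> cD lt_rc noD DD0 ker0 Dz Dw eq_zw.
have Dv : (w^-1 * z)%g \in pattern_group F cD by rewrite groupM ?groupV.
rewrite -[z](mulKVg w) cfkerMr //; apply: (subsetP ker0).
have v_rc : GLval (w^-1 * z)%g r c = 0.
  have /eqP := pattern_coordM lt_rc noD Dw Dv.
  by rewrite mulKVg eq_zw -subr_eq0 opprD addNKr oppr_eq0 => /eqP.
have /patternE[Uv zv] := Dv; apply/patternE; split=> // a b lt_ab nD0.
have [/andP[/eqP-> /eqP->] //|ne] := boolP ((a == r) && (b == c)).
apply: zv => //; apply: contra nD0 => /(DD0 a b lt_ab (leq_ord b)).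
by rewrite !val_eqE (negPf ne).
Qed.

End PatternCharacters.

(** * Characters that are not trivial on the centre *)

Section AlmostFaithful.
Import GroupScope.
Local Open Scope ring_scope.

Variables (F : finFieldType) (n : nat) (n_ge3 : (3 <= n)%N).
Local Notation I := 'I_n.-1.+1.
Local Notation GL := ({'GL_n[F]} : finGroupType).
Local Notation U := (unitri F n).
Local Notation pattern := (pattern F n).
Local Notation p := (ord_max : I).
Local Notation o := (ord0 : I).

Let lt_op : (o < p)%N. Proof. by rewrite /=; clear -n_ge3; lia. Qed.

(** S is the group V of the highest root: row 0 is reduced to the corner entry.
    A consists of the last column without its corner, and it pairs with the cells
    of row 0 that S lacks. *)
Let A_rel : rel nat := fun a b => (0 < a)%N && (b == n.-1).

Let cA : comp_rel n A_rel A_rel A_rel.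
Proof. rewrite /comp_rel /A_rel; clear -n_ge3; lia. Qed.

Let S := [group of Vgrp F n 1 n.-1].
Let R := [group of Rblock F n 2 (n - 2)].
Let H := [group of Ublock F n 2 (n - 2)].
Let A := pattern_group F cA.
Let Z : {group GL} := 1%G.

Let S_pat : S = pattern (armless 0 n.-1) :> {set GL}.
Proof. exact: (Vgrp_pattern F o p). Qed.

Let defU : R ><| H = U := Rblock_sdprod F n 2 (n - 2).

Let sHS : H \subset S.
Proof.
by rewrite S_pat /= Ublock_pattern pattern_sub // /blk /armless; clear -n_ge3; lia.
Qed.

Let sSU : S \subset U.
Proof. by rewrite S_pat pattern_unitri. Qed.

Let nAS : A <| S.
Proof.
rewrite /normal S_pat /=; apply/andP; split.
  by apply: pattern_sub; rewrite /A_rel /armless; clear -n_ge3; lia.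
by apply: pattern_norm; rewrite /comp_rel /A_rel /armless; clear -n_ge3; lia.
Qed.

Let sAR : A \subset R.
Proof.
by rewrite /= Rblock_pattern pattern_sub // /A_rel /blk; clear -n_ge3; lia.
Qed.

Let P_pat : S :&: R = pattern (fun a b => armless 0 n.-1 a b && ~~ blk 2 (n - 2) a b).
Proof. by rewrite S_pat /= Rblock_pattern patternI. Qed.

Let comPS : [~: S :&: R, S] \subset A.
Proof.
by rewrite P_pat S_pat; apply: pattern_commg => //;
  rewrite /comp_rel /armless /blk /A_rel; clear -n_ge3; lia.
Qed.

Let indexUS : #|U : S| = (#|F| ^ (n - 2))%N.
Proof.
rewrite S_pat unitri_pattern index_pattern //; last exact: armless_comp.
rewrite (@card_row_cells _ _ o 0 n.-1) /armless /=; try lia.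
by congr (_ ^ _)%N; clear -n_ge3; lia.
Qed.

Let indexAZ : #|A : Z| = (#|F| ^ (n - 2))%N.
Proof.
rewrite indexg1 /= card_pattern (@card_col_cells _ _ p 1 n.-1) //= /A_rel; try lia.
by congr (_ ^ _)%N; clear -n_ge3; lia.
Qed.

(** A nonzero entry in row j of the last column is moved to the corner by a root
    element at (0, j), so that the row operation changes the value by a nontrivial
    scalar. *)
Let corner_nontriv_van k x : corner_nontriv k -> x \in A -> x \notin Z -> 'chi_k x = 0.
Proof.
move=> gk Ax nZx; have [w Xw ne_w] := cfkerPn gk.
have /patternE[Ux zx] := Ax.
have [j /andP[j_gt0 nz_j]] : exists j : I, (0 < j < p)%N && (GLval x j p != 0).
  apply/existsP; apply: contraR nZx; rewrite negb_exists => /forallP no_j.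
  have A1 : (1%g : GL) \in pattern A_rel := group1 A.
  rewrite inE; apply/eqP/(pattern_eq Ax A1) => r c lt_rc /andP[r_gt0 /eqP Ec].
  have -> : c = p by apply/val_inj.
  have lt_rp : (r < p)%N by rewrite /= -[X in (_ < X)%N]Ec.
  have := no_j r; rewrite r_gt0 lt_rp GL_1E mxE -val_eqE (ltn_eqF lt_rp).
  by rewrite negbK => /eqP->.
case/andP: j_gt0 => j_gt0 lt_jp.
have Xz := @irr_vanish_row F n k x o j (corner n) j_gt0 Ux.
apply: Xz => [a|c lt_jc nz||].
- by have /unitriP-> := Ux.
- rewrite /corner eqxx /=; apply: contraR nz => ne_c.
  by rewrite zx // /A_rel j_gt0.
- exact: corner_cfcenter.
exists (GLval w o p / GLval x j p) => z Xz row_z.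
suff -> : z = w by [].
apply: (pattern_eq Xz Xw) => r c _ /andP[/eqP Er /eqP Ec].
have -> : r = o by apply/val_inj.
have -> : c = p by apply/val_inj.
by rewrite row_z // lt_jp divfK.
Qed.

Let noD (k : nat) : (o < k)%N -> (k < p)%N ->
  armless 0 n.-1 o k -> armless 0 n.-1 k p -> False.
Proof. by rewrite /armless /=; clear -n_ge3; lia. Qed.

Let clearA (r c : I) : (r < c)%N -> (r != o) || (c != p) -> ~~ A_rel r c ->
  ~~ (armless 0 n.-1 r c && ~~ blk 2 (n - 2) r c).
Proof.
by have := ltn_ord c; rewrite /armless /blk /A_rel -!val_eqE /=; clear -n_ge3; lia.
Qed.

Let exL (i : Iirr [set: F]) : exists2 xi : 'CF(S), xi \is a linear_char
  & {in S, forall g, xi g = 'chi_i (GLval g o p)}.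
Proof.
apply: lin_char_of_morph; first by rewrite GL1_offdiag ?addchar0.
move=> g h; rewrite /= S_pat => Vg Vh.
by rewrite (pattern_coordM lt_op noD Vg Vh) addcharD.
Qed.

Let Sx t : rootelt o p t \in S.
Proof. by rewrite S_pat rootelt_pattern // /armless /=; clear -n_ge3; lia. Qed.

Let Px t : rootelt o p t \in S :&: R.
Proof.
by rewrite P_pat rootelt_pattern // /armless /blk /=; clear -n_ge3; lia.
Qed.

Let Xx t : rootelt o p t \in pattern (corner n).
Proof. by rewrite rootelt_pattern // /corner /= eqxx. Qed.

Let cornerE g : g \in pattern (corner n) -> g = rootelt o p (GLval g o p).
Proof.
move=> Xg; apply: (pattern_eq Xg (Xx _)) => r c lt_rc /andP[/eqP Er /eqP Ec].
have -> : r = o by apply/val_inj.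
have -> : c = p by apply/val_inj.
by rewrite rootelt_coord // !eqxx mulr1.
Qed.

(** The fixed vectors of A afford a nontrivial additive character of the corner entry
    times a character of the central block. *)
Lemma almost_faithful_irr :
  (forall k : Iirr U, corner_nontriv k -> exists psi (j : Iirr H),
     [/\ elementary 1 n.-1 psi, almost_faithful psi,
         'chi_k 1%g = (#|F| ^ (n - 2))%:R * 'chi_j 1%g &
         'chi_k = psi * cfSdprod defU 'chi_j])
  /\ (forall d : nat,
       #|[set k : Iirr U | corner_nontriv k & 'chi_k 1%g == (#|F| ^ (n - 2) * d)%:R]| =
       ((#|F| - 1) * #|[set j : Iirr H | 'chi_j 1%g == d%:R]|)%N).
Proof.
have ex_star (i : Iirr [set: F]) : exists xi : 'CF(S), xi \is a linear_char
    /\ {in S, forall g, xi g = 'chi_i (GLval g o p)}.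
  by have [xi ? ?] := exL i; exists xi.
have [L /all_and2[linL LE]] := fin_all_exists ex_star.
have kerL i (B : {set GL}) : B \subset S ->
  {in B, forall g, GLval g o p = 0} -> B \subset cfker (L i).
  move=> sBS zB; apply/subsetP=> g Bg; have Sg := subsetP sBS g Bg.
  rewrite cfkerEchar ?lin_charW // inE Sg (lin_char1 (linL i)) LE // zB //.
  by rewrite addchar0 eqxx.
have kerLA i : A \subset cfker (L i).
  apply: kerL; first by case/andP: nAS.
  by move=> g /patternE[_ ->] //; rewrite /A_rel.
have kerLH i : H \subset cfker (L i).
  apply: kerL => // g; rewrite /= Ublock_pattern => /patternE[_ ->] //.
have injL : injective L.
  move=> i j eqL; apply: addchar_inj => t.
  by have := LE i _ (Sx t); rewrite eqL LE // rootelt_coord // !eqxx mulr1.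
pose J := [set i : Iirr [set: F] | i != 0].
have nontriv_intro i k (t : Iirr S) : i \in J -> t \in irr_constt ('Res[S] 'chi_k) ->
  {in S :&: R, forall x, 'chi_t x = 'chi_t 1%g * L i x} -> corner_nontriv k.
  rewrite inE => /addchar_nontrivial[u nz_u] kt tL; apply: contra_neqN nz_u => kerX.
  have sXS : pattern (corner n) \subset S.
    by apply/subsetP=> g /cornerE->; apply: Sx.
  have ker_u := subsetP (sub_cfker_constt_Res sXS kerX kt) _ (Xx u).
  have := irr_ratio_cfker ker_u (tL _ (Px u)).
  by rewrite LE // rootelt_coord // !eqxx mulr1.
have nontriv_elim k (t : Iirr S) (rho : 'CF(S :&: R)) :
  corner_nontriv k -> t \in irr_constt ('Res[S] 'chi_k) -> rho \is a linear_char ->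
  A \subset cfker 'chi_t ->
  {in S :&: R, forall x, 'chi_t x = 'chi_t 1%g * rho x} ->
  exists2 i, i \in J & {in S :&: R, rho =1 L i}.
  move=> gk kt Lrho kerA t_rho.
  have [i rho_i] :=
    @rootelt_addchar F n [group of S :&: R] rho o p lt_op Px Lrho.
  have rhoA g : g \in A -> rho g = 1.
    move=> Ag; have Pg : g \in S :&: R.
      by rewrite inE (subsetP sAR) // (subsetP (normal_sub nAS)).
    exact: irr_ratio_cfker (subsetP kerA g Ag) (t_rho g Pg).
  have rhoE : {in S :&: R, forall g, rho g = 'chi_i (GLval g o p)}.
    move=> g Pg.
    rewrite (lin_char_clear_entry (G := [group of S :&: R]) lt_op Lrho Px rho_i Pg).
    rewrite rhoA ?mul1r //; set h := rootelt _ _ _.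
    have Ph : h \in S :&: R by apply: Px.
    have : (g * h)%g \in [group of S :&: R] by apply: groupM.
    have [/setIP[Sg _] /setIP[Sh _]] := (Pg, Ph); rewrite S_pat in Sg Sh.
    have gh_op : GLval (g * h)%g o p = 0.
      have -> := pattern_coordM lt_op noD Sg Sh.
      by rewrite rootelt_coord // !eqxx mulr1 subrr.
    rewrite /= P_pat => /patternE[Ugh zgh]; apply/patternE; split=> // r c lt_rc.
    rewrite /A_rel => nArc.
    have [/andP[/eqP-> /eqP->] //|ne] := boolP ((r == o) && (c == p)).
    by apply: zgh => //; apply: clearA; rewrite // -negb_and.
  exists i; last by move=> g Pg; rewrite rhoE // LE //; case/setIP: Pg.
  rewrite inE; apply: contraNneq gk => i0.
  apply: (@constt_normal_cfker _ _ S (pattern_group F (@corner_comp n)) t k) => //.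
  - exact: corner_normal.
  - by apply/subsetP=> g /cornerE->; apply: Sx.
  apply/subsetP=> g /cornerE->; rewrite cfkerEirr inE t_rho // rho_i i0 irr0.
  by rewrite cfun1E inE mulr1.
have leUS : (#|U : S| <= #|A : Z|)%N by rewrite indexUS indexAZ.
have cardJ : #|J| = (#|F| - 1)%N := card_nontrivial_addchar F.
have gker k : corner_nontriv k -> Z \subset cfker 'chi_k by rewrite sub1G.
have T2form := semidirect_Hecke_form defU sHS sSU nAS (sub1G A) comPS leUS gker
  corner_nontriv_van linL nontriv_elim.
have T2irr := semidirect_Hecke_irr defU sHS sSU nAS sAR (sub1G A) leUS gker
  corner_nontriv_van linL kerLA nontriv_intro.
have T2card := semidirect_Hecke_card defU sHS sSU nAS sAR (sub1G A) comPS leUS gker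
  corner_nontriv_van linL kerLA kerLH injL nontriv_intro nontriv_elim.
split=> [k gk | d]; last by rewrite -cardJ -T2card indexUS.
have [i [j [Ji def_k]]] := T2form k gk; exists ('Ind[U] (L i)), j.
have nz_i : i != 0 by rewrite inE in Ji.
split=> //.
- split; first by rewrite /posroot; clear -n_ge3; lia.
  have [la sla laE] := elementary_exists lt_op nz_i.
  exists la => //; congr ('Ind[U] _); apply/cfun_inP=> g Sg.
  by rewrite LE // laE.
- have [l gl def_l] := T2irr i 0 Ji.
  rewrite irr0 rmorph1 mulr1 in def_l; rewrite -def_l.
  apply: contraNneq gl => triv; apply/subsetP=> g Xg.
  rewrite cfkerEirr inE; apply/eqP.
  have Zg : g \in 'Z(U).
    rewrite -cap_cfcenter_irr; apply/bigcapP=> m _.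
    exact: (subsetP (corner_cfcenter m)).
  have := congr1 (fun f : 'CF('Z(U)) => f g) triv.
  by rewrite /= cfResE ?center_sub // !cfunE cfun1E Zg mulr1.
by rewrite def_k cfunE cfInd1 // (lin_char1 (linL i)) mulr1 cfSdprod1 indexUS.
Qed.

End AlmostFaithful.

(** * Characters trivial on the centre but not on its two neighbours *)

Section SecondLayer.
Import GroupScope.
Local Open Scope ring_scope.

Variables (F : finFieldType) (n : nat) (n_ge5 : (5 <= n)%N).
Local Notation I := 'I_n.-1.+1.
Local Notation GL := ({'GL_n[F]} : finGroupType).
Local Notation U := (unitri F n).
Local Notation pattern := (pattern F n).
Local Notation p := (ord_max : I).
Local Notation o := (ord0 : I).
Let o1 : I := inord 1.
Let p1 : I := inord n.-2.

Let o1E : o1 = 1%N :> nat. Proof. by rewrite inordK //; clear -n_ge5; lia. Qed.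
Let p1E : p1 = n.-2 :> nat. Proof. by rewrite inordK //; clear -n_ge5; lia. Qed.

Let lt_oo1 : (o < o1)%N. Proof. by rewrite o1E. Qed.
Let lt_op1 : (o < p1)%N. Proof. by rewrite p1E /=; clear -n_ge5; lia. Qed.
Let lt_o1p : (o1 < p)%N. Proof. by rewrite o1E /=; clear -n_ge5; lia. Qed.

(** S keeps, above the central block, the entries (0, 1), (0, n - 2), (0, n - 1)
    and (1, n - 1); its linear characters below are those of the entries (0, n - 2),
    (1, n - 1) and (0, 1). A consists of the last two columns in the rows from 2 on
    and of the corner. The cells of A other than the corner pair with those that S
    lacks: (r, n - 2) with (0, r) and (r, n - 1) with (1, r). *)
Let S_rel : rel nat := fun a b =>
  ((a == 0)%N ==> ((b == 1)%N || (n.-2 <= b)%N)) && ((a == 1)%N ==> (b == n.-1)).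
Let A_rel : rel nat := fun a b =>
  ((1 < a)%N && (n.-2 <= b)%N) || ((a == 0)%N && (b == n.-1)).
Definition corner_row : rel nat := fun a b => (a == 0)%N && (n.-2 <= b)%N.
Definition corner_col : rel nat := fun a b => (a <= 1)%N && (b == n.-1).

Let cS : comp_rel n S_rel S_rel S_rel.
Proof. rewrite /comp_rel /S_rel; clear -n_ge5; lia. Qed.

Let cA : comp_rel n A_rel A_rel A_rel.
Proof. rewrite /comp_rel /A_rel; clear -n_ge5; lia. Qed.

Lemma corner_row_comp : comp_rel n corner_row corner_row corner_row.
Proof. rewrite /comp_rel /corner_row; clear -n_ge5; lia. Qed.

Lemma corner_col_comp : comp_rel n corner_col corner_col corner_col.
Proof. rewrite /comp_rel /corner_col; clear -n_ge5; lia. Qed.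

Lemma corner_row_normal : pattern_group F corner_row_comp <| unitri_group F n.
Proof.
apply: pattern_normal_unitri; rewrite /comp_rel /corner_row; clear -n_ge5; lia.
Qed.

Lemma corner_col_normal : pattern_group F corner_col_comp <| unitri_group F n.
Proof.
apply: pattern_normal_unitri; rewrite /comp_rel /corner_col; clear -n_ge5; lia.
Qed.

Let S := pattern_group F cS.
Let R := [group of Rblock F n 3 (n - 3)].
Let H := [group of Ublock F n 3 (n - 3)].
Let A := pattern_group F cA.
Let Z := pattern_group F (@corner_comp n).

Let defU : R ><| H = U := Rblock_sdprod F n 3 (n - 3).

Let sHS : H \subset S.
Proof. rewrite /= Ublock_pattern pattern_sub // /blk /S_rel; clear -n_ge5; lia. Qed.

Let sSU : S \subset U := pattern_unitri F n S_rel.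

Let sAS : A \subset S.
Proof. by apply: pattern_sub; rewrite /A_rel /S_rel; clear -n_ge5; lia. Qed.

Let nAS : A <| S.
Proof.
rewrite /normal sAS /=.
by apply: pattern_norm; rewrite /comp_rel /A_rel /S_rel; clear -n_ge5; lia.
Qed.

Let sAR : A \subset R.
Proof. by rewrite /= Rblock_pattern pattern_sub // /A_rel /blk; clear -n_ge5; lia. Qed.

Let sZA : Z \subset A.
Proof. by apply: pattern_sub; rewrite /corner /A_rel; clear -n_ge5; lia. Qed.

Let P_rel : rel nat := fun a b => S_rel a b && ~~ blk 3 (n - 3) a b.

Let P_pat : S :&: R = pattern P_rel.
Proof. by rewrite /= Rblock_pattern patternI. Qed.

Let comPS : [~: S :&: R, S] \subset A.
Proof.
by rewrite P_pat; apply: pattern_commg => //;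
  rewrite /comp_rel /P_rel /S_rel /blk /A_rel; clear -n_ge5; lia.
Qed.

Let indexUS : #|U : S| = (#|F| ^ (2 * n - 7))%N.
Proof.
rewrite unitri_pattern index_pattern //; congr (_ ^ _)%N.
rewrite (@card_cellsID n _ (fun a b => a == 0)%N).
rewrite (@card_row_cells n _ o 1 n.-2);
  try by rewrite /S_rel /=; clear -n_ge5; lia.
rewrite (@card_row_cells n _ o1 1 n.-1);
  by rewrite ?o1E /S_rel /=; clear -n_ge5; lia.
Qed.

Let indexAZ : #|A : Z| = (#|F| ^ (2 * n - 7))%N.
Proof.
rewrite index_pattern //; first last.
- by move=> r c lt_rc le_c; rewrite /corner /A_rel; clear -n_ge5; lia.
- exact: corner_comp.
congr (_ ^ _)%N.
rewrite (@card_cellsID n _ (fun a b => b == n.-1)%N).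
rewrite (@card_col_cells n _ p 2 n.-1);
  try by rewrite /A_rel /corner /=; clear -n_ge5; lia.
rewrite (@card_col_cells n _ p1 2 n.-2);
  by rewrite ?p1E /A_rel /corner /=; clear -n_ge5; lia.
Qed.

Definition neighbours_nontriv (k : Iirr U) :=
  [&& pattern (corner n) \subset cfker 'chi_k,
  ~~ (pattern corner_row \subset cfker 'chi_k) &
  ~~ (pattern corner_col \subset cfker 'chi_k)].

Let corner_row_cfcenter k : pattern (corner n) \subset cfker 'chi_k ->
  pattern corner_row \subset 'Z('chi[U]_k)%CF.
Proof.
apply: pattern_cfcenter => //;
  by rewrite /comp_rel /corner_row /corner; clear -n_ge5; lia.
Qed.

Let corner_col_cfcenter k : pattern (corner n) \subset cfker 'chi_k ->
  pattern corner_col \subset 'Z('chi[U]_k)%CF.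
Proof.
apply: pattern_cfcenter => //;
  by rewrite /comp_rel /corner_col /corner; clear -n_ge5; lia.
Qed.

Let top_noD (k : nat) : (o < k)%N -> (k < p1)%N ->
  corner_row o k -> corner_row k p1 -> False.
Proof. by rewrite p1E /corner_row /=; clear -n_ge5; lia. Qed.

Let last_noD (k : nat) : (o1 < k)%N -> (k < p)%N ->
  corner_col o1 k -> corner_col k p -> False.
Proof. by rewrite o1E /corner_col /=; clear -n_ge5; lia. Qed.

Let topD (a b : nat) : (a < b)%N -> (b <= n.-1)%N -> corner_row a b ->
  ((a == o) && (b == p1)) || corner n a b.
Proof. by rewrite p1E /corner_row /corner /=; clear -n_ge5; lia. Qed.

Let lastD (a b : nat) : (a < b)%N -> (b <= n.-1)%N -> corner_col a b ->
  ((a == o1) && (b == p)) || corner n a b.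
Proof. by rewrite o1E /corner_col /corner /=; clear -n_ge5; lia. Qed.

Let nA_row1 (a : nat) : ~~ A_rel a 1.
Proof. by rewrite /A_rel; clear -n_ge5; lia. Qed.

Let A_low (a b : nat) : (1 < a)%N -> ~~ (n.-2 <= b)%N -> ~~ A_rel a b.
Proof. by rewrite /A_rel; clear -n_ge5; lia. Qed.

Let A_cases (a b : nat) : (a < b)%N -> (b <= n.-1)%N -> A_rel a b ->
  ~~ corner n a b -> (1 < a)%N /\ (b = n.-2 \/ b = n.-1).
Proof. by rewrite /A_rel /corner; clear -n_ge5; lia. Qed.

(** A nonzero entry (j, n - 2) is moved to row 0 by a root element at (0, j). When there
    is none, a nonzero entry (j, n - 1) is moved to row 1 by a root element at (1, j);
    this includes j = n - 2. *)
Let neighbours_nontriv_van k x :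
  neighbours_nontriv k -> x \in A -> x \notin Z -> 'chi_k x = 0.
Proof.
case/and3P=> kerX nkT nkL Ax nZx; have /patternE[Ux zx] := Ax.
have [j /and3P[j_gt1 lt_jp1 nz_j]|no_j] :=
    pickP (fun j : I => [&& (1 < j)%N, (j < p1)%N & GLval x j p1 != 0]).
  have [w Tw ne_w] := cfkerPn nkT.
  apply: (@irr_vanish_row F n k x o j corner_row) => //; first exact: ltn_trans j_gt1.
  - by move=> a; have /unitriP-> := Ux.
  - move=> c lt_jc nz; rewrite /corner_row eqxx /=; apply: contraR nz => le_c.
    by rewrite zx // A_low.
  - exact: corner_row_cfcenter.
  exists (GLval w o p1 / GLval x j p1) => z Tz row_z.
  rewrite (irr_eq_mod corner_row_comp lt_op1 top_noD topD kerX Tz Tw) //.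
  by rewrite row_z // lt_jp1 divfK.
have [j /and3P[j_gt1 lt_jp nz_j]|no_j'] :=
    pickP (fun j : I => [&& (1 < j)%N, (j < p)%N & GLval x j p != 0]).
  have [w Lw ne_w] := cfkerPn nkL.
  apply: (@irr_vanish_row F n k x o1 j corner_col) => //.
  - by rewrite o1E.
  - move=> a; have [le_ao1|lt_ao1] := leqP o1 a; first by have /unitriP-> := Ux.
    by rewrite -val_eqE (ltn_eqF lt_ao1) zx // o1E nA_row1.
  - move=> c lt_jc nz; rewrite /corner_col o1E /=.
    have Ajc : A_rel j c by apply: contraR nz => /zx->.
    have nX : ~~ corner n j c by rewrite /corner; case: (j : nat) j_gt1.
    have [_ [Ec|->]] := A_cases lt_jc (leq_ord c) Ajc nX; last by rewrite eqxx.
    have lt_jp1 : (j < p1)%N by rewrite p1E -Ec.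
    have := no_j j; rewrite j_gt1 lt_jp1 /=.
    have -> : p1 = c by apply/val_inj; rewrite /= Ec p1E.
    by rewrite nz.
  - exact: corner_col_cfcenter.
  exists (GLval w o1 p / GLval x j p) => z Lz row_z.
  rewrite (irr_eq_mod corner_col_comp lt_o1p last_noD lastD kerX Lz Lw) //.
  by rewrite row_z // lt_jp divfK.
case/negP: nZx; apply/patternE; split=> // r c lt_rc nX.
apply/eqP/idPn => nz; have Arc : A_rel r c by apply: contraR nz => /zx->.
have [r_gt1 [Ec|Ec]] := A_cases lt_rc (leq_ord c) Arc nX.
  have cE : c = p1 by apply/val_inj; rewrite /= Ec p1E.
  by have := no_j r; rewrite r_gt1 -cE lt_rc nz.
have cE : c = p by apply/val_inj.
by have := no_j' r; rewrite r_gt1 -cE lt_rc nz.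
Qed.

Let S_noD_op1 (k : nat) : (o < k)%N -> (k < p1)%N ->
  S_rel o k -> S_rel k p1 -> False.
Proof. by rewrite p1E /S_rel /=; clear -n_ge5; lia. Qed.

Let S_noD_o1p (k : nat) : (o1 < k)%N -> (k < p)%N ->
  S_rel o1 k -> S_rel k p -> False.
Proof. by rewrite o1E /S_rel /=; clear -n_ge5; lia. Qed.

Let noD_oo1 (D : rel nat) (k : nat) :
  (o < k)%N -> (k < o1)%N -> D o k -> D k o1 -> False.
Proof. by rewrite o1E /=; case: k. Qed.

Let clearA (r c : nat) : (r < c)%N -> (c <= n.-1)%N ->
  ~~ ((r == o) && (c == p1)) -> ~~ ((r == o1) && (c == p)) ->
  ~~ ((r == o) && (c == o1)) -> ~~ A_rel r c -> ~~ P_rel r c.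
Proof.
by rewrite o1E p1E /P_rel /S_rel /blk /A_rel /=; clear -n_ge5; lia.
Qed.

Let P_op1 : P_rel o p1.
Proof. by rewrite p1E /P_rel /S_rel /blk /=; clear -n_ge5; lia. Qed.
Let P_o1p : P_rel o1 p.
Proof. by rewrite o1E /P_rel /S_rel /blk /=; clear -n_ge5; lia. Qed.
Let P_oo1 : P_rel o o1. Proof. by rewrite o1E. Qed.

Let nA_op1 : ~~ A_rel o p1. Proof. by rewrite p1E /A_rel /=; clear -n_ge5; lia. Qed.
Let nA_o1p : ~~ A_rel o1 p. Proof. by rewrite o1E /A_rel. Qed.
Let nA_oo1 : ~~ A_rel o o1. Proof. by rewrite o1E /A_rel /=; clear -n_ge5; lia. Qed.

Let neq_oo1 : (o == o1) = false. Proof. by rewrite -val_eqE /= o1E. Qed.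
Let neq_p1o1 : (p1 == o1) = false.
Proof. by rewrite -val_eqE /= o1E p1E; clear -n_ge5; lia. Qed.

Let sTS : pattern corner_row \subset S.
Proof. by apply: pattern_sub; rewrite /corner_row /S_rel; clear -n_ge5; lia. Qed.

Let sLS : pattern corner_col \subset S.
Proof. by apply: pattern_sub; rewrite /corner_col /S_rel; clear -n_ge5; lia. Qed.

Let sTP : pattern corner_row \subset S :&: R.
Proof.
by rewrite P_pat; apply: pattern_sub; rewrite /corner_row /P_rel /S_rel /blk;
  clear -n_ge5; lia.
Qed.

Let sLP : pattern corner_col \subset S :&: R.
Proof.
by rewrite P_pat; apply: pattern_sub; rewrite /corner_col /P_rel /S_rel /blk;
  clear -n_ge5; lia.
Qed.

Let T_op1 : corner_row o p1. Proof. by rewrite /corner_row p1E /=. Qed.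
Let L_o1p : corner_col o1 p. Proof. by rewrite /corner_col o1E /= eqxx. Qed.
Let nT_o1p : ~~ corner_row o1 p. Proof. by rewrite /corner_row o1E. Qed.
Let nT_oo1 : ~~ corner_row o o1.
Proof. by rewrite /corner_row o1E /=; clear -n_ge5; lia. Qed.

Let nblk_o1p : ~~ blk 3 (n - 3) o1 p. Proof. by rewrite /blk o1E. Qed.

Local Notation chars := (Iirr [set: F] * Iirr [set: F] * Iirr [set: F])%type.

Let coord_char (a : chars) (g : GL) : algC :=
  'chi_(a.1.1) (GLval g o p1) * 'chi_(a.1.2) (GLval g o1 p)
    * 'chi_(a.2) (GLval g o o1).

Let coord_char_mul a :
  {in S &, forall g h, coord_char a (g * h)%g = coord_char a g * coord_char a h}.
Proof.
move=> g h Sg Sh; rewrite /coord_char.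
rewrite (pattern_coordM lt_op1 S_noD_op1 Sg Sh) (pattern_coordM lt_o1p S_noD_o1p Sg Sh).
rewrite (pattern_coordM lt_oo1 (@noD_oo1 _) Sg Sh) !addcharD; ring.
Qed.

Let coord_char_0 a g : GLval g o p1 = 0 -> GLval g o1 p = 0 -> GLval g o o1 = 0 ->
  coord_char a g = 1.
Proof. by rewrite /coord_char => -> -> ->; rewrite !addchar0 !mulr1. Qed.

Let rootS (r c : I) t : (r < c)%N -> P_rel r c -> rootelt r c t \in S :&: R.
Proof. by rewrite P_pat; apply: rootelt_pattern. Qed.

(** The three coordinates are cleared one after the other; what is left lies in A. *)
Let rho_coord_char (rho : 'CF(S :&: R)) : rho \is a linear_char ->
    {in A, forall g, rho g = 1} ->
  exists a : chars, {in S :&: R, rho =1 coord_char a}.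
Proof.
move=> Lrho rhoA.
have x1 t := rootS t lt_op1 P_op1; have x2 t := rootS t lt_o1p P_o1p.
have x3 t := rootS t lt_oo1 P_oo1.
have [i1 rho1] := rootelt_addchar lt_op1 x1 Lrho.
have [i2 rho2] := rootelt_addchar lt_o1p x2 Lrho.
have [i3 rho3] := rootelt_addchar lt_oo1 x3 Lrho.
exists (i1, i2, i3) => g Pg.
rewrite (lin_char_clear_entry lt_op1 Lrho x1 rho1 Pg); set g1 := (g * _)%g.
have Pg1 : g1 \in S :&: R by rewrite groupM.
rewrite (lin_char_clear_entry lt_o1p Lrho x2 rho2 Pg1); set g2 := (g1 * _)%g.
have Pg2 : g2 \in S :&: R by rewrite groupM.
rewrite (lin_char_clear_entry lt_oo1 Lrho x3 rho3 Pg2); set g3 := (g2 * _)%g.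
have Pg3 : g3 \in S :&: R by rewrite groupM.
have inS h : h \in S :&: R -> h \in S by case/setIP.
have cd1 h h' Ph Ph' := pattern_coordM lt_op1 S_noD_op1 (inS h Ph) (inS h' Ph').
have cd2 h h' Ph Ph' := pattern_coordM lt_o1p S_noD_o1p (inS h Ph) (inS h' Ph').
have cd3 h h' Ph Ph' := pattern_coordM lt_oo1 (@noD_oo1 S_rel) (inS h Ph) (inS h' Ph').
have g1_o1p : GLval g1 o1 p = GLval g o1 p.
  by rewrite cd2 // rootelt_coord // [o1 == o]eq_sym neq_oo1 mulr0 addr0.
have g2_oo1 : GLval g2 o o1 = GLval g o o1.
  rewrite cd3 // rootelt_coord // neq_oo1 mulr0 addr0 cd3 // rootelt_coord //.
  by rewrite [o1 == p1]eq_sym neq_p1o1 andbF mulr0 addr0.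
rewrite g1_o1p g2_oo1 rhoA; first by rewrite /coord_char /=; ring.
have g1_op1 : GLval g1 o p1 = 0.
  by rewrite cd1 // rootelt_coord // !eqxx mulr1 subrr.
have g3_op1 : GLval g3 o p1 = 0.
  rewrite cd1 // rootelt_coord // neq_p1o1 andbF mulr0 addr0 cd1 //.
  by rewrite rootelt_coord // neq_oo1 mulr0 addr0.
have g3_o1p : GLval g3 o1 p = 0.
  rewrite cd2 // rootelt_coord // [o1 == o]eq_sym neq_oo1 mulr0 addr0 cd2 //.
  by rewrite rootelt_coord // !eqxx mulr1 subrr.
have g3_oo1 : GLval g3 o o1 = 0.
  by rewrite cd3 // rootelt_coord // !eqxx mulr1 subrr.
rewrite P_pat in Pg3; have /patternE[Ug3 zg3] := Pg3.
apply/patternE; split=> // r c lt_rc nA.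
have [/andP[/eqP-> /eqP->] //|ne1] := boolP ((r == o) && (c == p1)).
have [/andP[/eqP-> /eqP->] //|ne2] := boolP ((r == o1) && (c == p)).
have [/andP[/eqP-> /eqP->] //|ne3] := boolP ((r == o) && (c == o1)).
by apply: zg3 => //; apply: clearA; rewrite ?leq_ord.
Qed.

Let V1 := [group of Vgrp F n o.+1 p1].
Let V2 := [group of Vgrp F n o1.+1 p].

Let V1_pat : V1 = pattern (armless o p1) :> {set GL}.
Proof. exact: Vgrp_pattern. Qed.

Let V2_pat : V2 = pattern (armless o1 p) :> {set GL}.
Proof. exact: Vgrp_pattern. Qed.

Let sV1U : V1 \subset U. Proof. by rewrite V1_pat pattern_unitri. Qed.
Let sV2U : V2 \subset U. Proof. by rewrite V2_pat pattern_unitri. Qed.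

Let sSV2 : S \subset V2.
Proof. by rewrite V2_pat pattern_sub // o1E /S_rel /armless /=; clear -n_ge5; lia. Qed.

Let S0_rel : rel nat := fun a b => S_rel a b && armless o p1 a b.

Let cS0 : comp_rel n S0_rel S0_rel S0_rel.
Proof. by rewrite /comp_rel /S0_rel /S_rel /armless p1E /=; clear -n_ge5; lia. Qed.

Let S0 := pattern_group F cS0.

Let sS0S : S0 \subset S.
Proof. by apply: pattern_sub => r c _ _ /andP[]. Qed.

Let sS0V1 : S0 \subset V1.
Proof. by rewrite V1_pat; apply: pattern_sub => r c _ _ /andP[]. Qed.

Let comSS0 : [~: S, S] \subset S0.
Proof.
by apply: pattern_commg => //; rewrite /comp_rel /S0_rel /S_rel /armless p1E /=;
  clear -n_ge5; lia.
Qed.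

Let nS0S : S0 <| S.
Proof.
rewrite /normal sS0S /=; apply: pattern_norm => //;
  rewrite /comp_rel /S0_rel /S_rel /armless p1E /=; clear -n_ge5; lia.
Qed.

Let clearS0 (r c : nat) : (r < c)%N -> (c <= n.-1)%N ->
  ~~ ((r == o) && (c == o1)) -> ~~ S0_rel r c -> ~~ S_rel r c.
Proof.
by rewrite o1E /S0_rel /S_rel /armless p1E /=; clear -n_ge5; lia.
Qed.

Let nV1_oo1 : ~~ armless o p1 o o1.
Proof. by rewrite /armless p1E o1E /=; clear -n_ge5; lia. Qed.

(** Some linear character of S extending that of V1 on the intersection is a
    constituent, and its factor depending on the entry (0, 1) can be changed at will:
    an additive character of this entry is a linear character of U trivial on V1, so
    that it does not change the induced character. *)
Let constt_arm (la : 'CF(V1)) (i1 i3 : Iirr [set: F]) (k : Iirr S) :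
    la \is a linear_char -> {in V1, forall g, la g = 'chi_i1 (GLval g o p1)} ->
    {in S, forall g, 'chi_k g = 'chi_i1 (GLval g o p1) * 'chi_i3 (GLval g o o1)} ->
  k \in irr_constt ('Res[S] ('Ind[U] la)).
Proof.
move=> Lla laE kE; set psi := 'Ind[U] la.
have Npsi : psi \is a character by rewrite cfInd_char ?lin_charW.
have chi1M : {in S &, forall g h,
    'chi_i1 (GLval (g * h)%g o p1) = 'chi_i1 (GLval g o p1) * 'chi_i1 (GLval h o p1)}.
  by move=> g h Sg Sh; rewrite (pattern_coordM lt_op1 S_noD_op1 Sg Sh) addcharD.
have [|M LM ME] := lin_char_of_morph _ chi1M; first by rewrite GL1_offdiag ?addchar0.
have /irrP[v def_v] := lin_char_irr Lla.
have L0 : 'Res[S0] la \is a linear_char by apply: cfRes_lin_char.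
have /irrP[a def_a] := lin_char_irr L0.
have psi_a : a \in irr_constt ('Res[S0] psi).
  rewrite -(cfResRes _ sS0V1 sV1U).
  have vV1 : v \in irr_constt ('Res[V1] psi).
    by rewrite /psi def_v constt_Res_Ind_self.
  apply: (constt_Res_trans _ vV1); first by rewrite cfRes_char.
  by rewrite -def_v def_a constt_irr inE.
have [t psi_t ta] := constt_Res_lift Npsi sSU sS0S psi_a.
have LM' : M^*%CF \is a linear_char by rewrite cfConjC_lin_char.
have /irrP[s def_s] := mul_lin_irr LM' (mem_irr t).
have s0 : (0 : Iirr S0) \in irr_constt ('Res[S0] 'chi_s).
  move: ta; rewrite !irr_consttE irr0 -def_s -def_a; congr (_ != 0).
  rewrite !cfdotE; congr (_ * _); apply: eq_bigr => g S0g.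
  have Sg := subsetP sS0S g S0g; have V1g := subsetP sS0V1 g S0g.
  rewrite !cfResE // cfun1E S0g conjC1 mulr1 cfunE cfunE laE // ME //.
  by rewrite mulrC.
have kerS0 := constt0_Res_cfker nS0S s0.
have Ls : 'chi_s \is a linear_char.
  by rewrite lin_irr_der1; apply: subset_trans kerS0.
have xS u : rootelt o o1 u \in S.
  by have /setIP[] := rootS u lt_oo1 P_oo1.
have [i s_i] := rootelt_addchar lt_oo1 xS Ls.
have sE : {in S, forall g, 'chi_s g = 'chi_i (GLval g o o1)}.
  move=> g Sg; rewrite (lin_char_clear_entry lt_oo1 Ls xS s_i Sg).
  set h := (g * _)%g; suff S0h : h \in S0.
    by rewrite (cfker1 (subsetP kerS0 h S0h)) lin_char1 // mul1r.
  have Sh : h \in S by rewrite groupM.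
  have h0 : GLval h o o1 = 0.
    rewrite (pattern_coordM lt_oo1 (@noD_oo1 S_rel) Sg (xS _)).
    by rewrite rootelt_coord // !eqxx mulr1 subrr.
  have /patternE[Uh zh] := Sh; apply/patternE; split=> // r c lt_rc nS0.
  have [/andP[/eqP-> /eqP->] //|ne] := boolP ((r == o) && (c == o1)).
  by apply: zh => //; apply: clearS0; rewrite ?leq_ord.
have tE : {in S, forall g, 'chi_t g = 'chi_i1 (GLval g o p1) * 'chi_i (GLval g o o1)}.
  move=> g Sg; rewrite -sE // -def_s -ME // !cfunE mulrA [M g * _]mulrC.
  by rewrite lin_char_conjK // mul1r.
pose h (u : F) : algC := 'chi_i3 u / 'chi_i u.
have [||i' i'E] := @addchar_exists F h.
- by rewrite /h !addchar0 divr1.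
- by move=> u u'; rewrite /h !addcharD invfM; ring.
have chi'M : {in U &, forall g g',
    'chi_i' (GLval (g * g')%g o o1) = 'chi_i' (GLval g o o1) * 'chi_i' (GLval g' o o1)}.
  rewrite unitri_pattern => g g' Ug Ug'.
  by rewrite (pattern_coordM lt_oo1 (@noD_oo1 (fun _ _ => true)) Ug Ug') addcharD.
have [|nu Lnu nuE] := lin_char_of_morph _ chi'M; first by rewrite GL1_offdiag ?addchar0.
have psi_nu : psi = psi * nu.
  rewrite -cfIndM //; congr ('Ind[U] _); apply/cfun_inP=> g V1g.
  have Ug := subsetP sV1U g V1g.
  rewrite cfunE cfResE // nuE //.
  have /patternE[_ ->] // : g \in pattern (armless o p1) by rewrite -V1_pat.
  by rewrite addchar0 mulr1.
have [r Nr def_r] := constt_charP _ (cfRes_char S Npsi) psi_t.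
apply/constt_charP; first by rewrite cfRes_char.
exists (r * 'Res[S] nu); first by rewrite rpredM // cfRes_char ?lin_charW.
have -> : 'Res[S] psi = 'Res[S] psi * 'Res[S] nu by rewrite -rmorphM -psi_nu.
rewrite def_r mulrDl; congr (_ + _).
apply/cfun_inP=> g Sg; rewrite cfunE cfResE // nuE ?(subsetP sSU) // tE // kE //.
by rewrite i'E /h -mulrA [_ * (_ / _)]mulrC divfK ?addchar_neq0.
Qed.

(** The q characters of the entry (0, 1) distinguish the constituents of the product
    of two elementary characters. *)
Lemma second_layer_irr :
  (forall k : Iirr U, neighbours_nontriv k ->
   exists (psi1 psi2 : 'CF(U)) (l : Iirr U) (j : Iirr H),
     [/\ elementary 1 n.-2 psi1 /\ elementary 2 n.-1 psi2,
         l \in irr_constt (psi1 * psi2),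
         'chi_k 1%g = (#|F| ^ (2 * n - 7))%:R * 'chi_j 1%g &
         'chi_k = 'chi_l * cfSdprod defU 'chi_j])
  /\ (forall d : nat,
       #|[set k : Iirr U |
           neighbours_nontriv k & 'chi_k 1%g == (#|F| ^ (2 * n - 7) * d)%:R]| =
       (#|F| * (#|F| - 1) ^ 2 * #|[set j : Iirr H | 'chi_j 1%g == d%:R]|)%N).
Proof.
have ex_L (a : chars) : exists xi : 'CF(S), xi \is a linear_char
    /\ {in S, xi =1 coord_char a}.
  have [|xi Lxi xiE] := lin_char_of_morph _ (@coord_char_mul a); last by exists xi.
  by rewrite coord_char_0 ?GL1_offdiag.
have [L /all_and2[linL LE]] := fin_all_exists ex_L.
have kerL a (B : {set GL}) : B \subset S ->
    {in B, forall g, [/\ GLval g o p1 = 0, GLval g o1 p = 0 & GLval g o o1 = 0]} ->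
  B \subset cfker (L a).
  move=> sBS zB; apply/subsetP=> g Bg; have Sg := subsetP sBS g Bg.
  rewrite cfkerEchar ?lin_charW // inE Sg (lin_char1 (linL a)) LE //.
  by have [z1 z2 z3] := zB g Bg; rewrite coord_char_0 // eqxx.
have kerLA a : A \subset cfker (L a).
  by apply: kerL => // g /patternE[_ zg]; split; apply: zg.
have kerLH a : H \subset cfker (L a).
  apply: kerL => // g; rewrite /= Ublock_pattern => /patternE[_ zg].
  by split; apply: zg.
have v1 a u : coord_char a (rootelt o p1 u) = 'chi_(a.1.1) u.
  rewrite /coord_char !rootelt_coord // !eqxx [o1 == o]eq_sym neq_oo1.
  by rewrite [o1 == p1]eq_sym neq_p1o1 !mulr0 mulr1 !addchar0 !mulr1.
have v2 a u : coord_char a (rootelt o1 p u) = 'chi_(a.1.2) u.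
  rewrite /coord_char !rootelt_coord // !eqxx neq_oo1.
  by rewrite !mulr0 mulr1 !addchar0 mulr1 mul1r.
have v3 a u : coord_char a (rootelt o o1 u) = 'chi_(a.2) u.
  rewrite /coord_char !rootelt_coord // !eqxx neq_p1o1 [o1 == o]eq_sym neq_oo1.
  by rewrite !mulr0 mulr1 !addchar0 !mul1r.
have x1 t := rootS t lt_op1 P_op1; have x2 t := rootS t lt_o1p P_o1p.
have x3 t := rootS t lt_oo1 P_oo1.
have inS h : h \in S :&: R -> h \in S by case/setIP.
have injL : injective L.
  move=> [[i1 i2] i3] [[j1 j2] j3] eqL.
  have eqv g : g \in S -> coord_char (i1, i2, i3) g = coord_char (j1, j2, j3) g.
    by move=> Sg; rewrite -!LE // eqL.
  congr (_, _, _); apply: addchar_inj => t.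
  - by have := eqv _ (inS _ (x1 t)); rewrite !v1.
  - by have := eqv _ (inS _ (x2 t)); rewrite !v2.
  by have := eqv _ (inS _ (x3 t)); rewrite !v3.
pose J0 := [set i : Iirr [set: F] | i != 0].
pose J : {set chars} := setX (setX J0 J0) setT.
have normal_up (N : {group GL}) (t : Iirr S) (k : Iirr U) :
    N <| unitri_group F n -> N \subset S ->
    t \in irr_constt ('Res[S] 'chi_k) -> N \subset cfker 'chi_t ->
    N \subset cfker 'chi_k.
  by move=> nN sNS kt; apply: constt_normal_cfker kt.
have nontriv_intro (a : chars) (k : Iirr U) (t : Iirr S) :
  a \in J -> t \in irr_constt ('Res[S] 'chi_k) ->
  {in S :&: R, forall x, 'chi_t x = 'chi_t 1%g * L a x} -> neighbours_nontriv k.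
  rewrite /J !inE andbT => /andP[nz1 nz2] kt tL.
  have nontriv (N : {set GL}) x : N \subset S -> x \in N -> x \in S :&: R ->
      N \subset cfker 'chi_k -> L a x = 1.
    move=> sNS Nx Px kerN.
    have ker_x := subsetP (sub_cfker_constt_Res sNS kerN kt) x Nx.
    exact: irr_ratio_cfker ker_x (tL x Px).
  apply/and3P; split.
  - apply: (normal_up (pattern_group F (@corner_comp n)) t k) => //.
    + exact: corner_normal.
    + exact: subset_trans sZA sAS.
    apply/subsetP=> g Xg; have Ag := subsetP sZA g Xg.
    have Pg : g \in S :&: R by rewrite inE (subsetP sAS) // (subsetP sAR).
    rewrite cfkerEirr inE tL //.
    by rewrite (cfker1 (subsetP (kerLA a) g Ag)) (lin_char1 (linL a)) mulr1.
  - have [u nz_u] := addchar_nontrivial nz1; apply: contra_neqN nz_u => kerT.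
    rewrite -v1 -LE ?inS // (nontriv _ _ sTS) //.
    exact: rootelt_pattern.
  have [u nz_u] := addchar_nontrivial nz2; apply: contra_neqN nz_u => kerT.
  rewrite -v2 -LE ?inS // (nontriv _ _ sLS) //.
  exact: rootelt_pattern.
have nontriv_elim (k : Iirr U) (t : Iirr S) (rho : 'CF(S :&: R)) :
  neighbours_nontriv k -> t \in irr_constt ('Res[S] 'chi_k) -> rho \is a linear_char ->
  A \subset cfker 'chi_t ->
  {in S :&: R, forall x, 'chi_t x = 'chi_t 1%g * rho x} ->
  exists2 a, a \in J & {in S :&: R, rho =1 L a}.
  case/and3P=> _ nkT nkL kt Lrho kerA t_rho.
  have rhoA : {in A, forall g, rho g = 1}.
    move=> g Ag; have Pg : g \in S :&: R.
      by rewrite inE (subsetP sAR) // (subsetP sAS).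
    exact: irr_ratio_cfker (subsetP kerA g Ag) (t_rho g Pg).
  have [[[i1 i2] i3] rhoE] := rho_coord_char Lrho rhoA.
  exists (i1, i2, i3); last by move=> g Pg; rewrite rhoE // LE ?inS.
  rewrite /J !inE /= andbT; apply/andP; split.
    apply: contraNneq nkT => i1_0.
    apply: (normal_up (pattern_group F corner_row_comp) t k) => //.
      exact: corner_row_normal.
    apply/subsetP=> g Tg; rewrite cfkerEirr inE t_rho ?(subsetP sTP) //.
    rewrite rhoE ?(subsetP sTP) // /coord_char /= i1_0 irr0 cfun1E inE.
    have /patternE[_ zg] := Tg.
    by rewrite (zg _ _ lt_o1p) // (zg _ _ lt_oo1) // !addchar0 !mulr1.
  apply: contraNneq nkL => i2_0.
  apply: (normal_up (pattern_group F corner_col_comp) t k) => //.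
    exact: corner_col_normal.
  apply/subsetP=> g Lg; rewrite cfkerEirr inE t_rho ?(subsetP sLP) //.
  rewrite rhoE ?(subsetP sLP) // /coord_char /= i2_0 irr0 cfun1E inE.
  have /patternE[_ zg] := Lg.
  by rewrite (zg _ _ lt_op1) // (zg _ _ lt_oo1) // !addchar0 !mulr1.
have leUS : (#|U : S| <= #|A : Z|)%N by rewrite indexUS indexAZ.
have cardJ : #|J| = (#|F| * (#|F| - 1) ^ 2)%N.
  have cardJ0 : #|J0| = (#|F| - 1)%N := card_nontrivial_addchar F.
  by rewrite !cardsX cardJ0 cardsT card_addchar mulnC mulnn.
have gker k : neighbours_nontriv k -> Z \subset cfker 'chi_k by case/and3P.
have T2form := semidirect_Hecke_form defU sHS sSU nAS sZA comPS leUS gker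
  neighbours_nontriv_van linL nontriv_elim.
have T2irr := semidirect_Hecke_irr defU sHS sSU nAS sAR sZA leUS gker
  neighbours_nontriv_van linL kerLA nontriv_intro.
have T2card := semidirect_Hecke_card defU sHS sSU nAS sAR sZA comPS leUS gker
  neighbours_nontriv_van linL kerLA kerLH injL nontriv_intro nontriv_elim.
split=> [k gk | d]; last by rewrite -cardJ -T2card indexUS.
have [a [j [Ja def_k]]] := T2form k gk.
have [l _ def_l] := T2irr a 0 Ja; rewrite irr0 rmorph1 mulr1 in def_l.
have [nz1 nz2] : a.1.1 != 0 /\ a.1.2 != 0.
  by move: Ja; rewrite /J !inE andbT => /andP.
have [la1 sla1 la1E] := elementary_exists lt_op1 nz1.
have [la2 sla2 la2E] := elementary_exists lt_o1p nz2.
have [psi1 def_psi1] : exists psi, psi = 'Ind[U] la1 by exists ('Ind[U] la1).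
have [psi2 def_psi2] : exists psi, psi = 'Ind[U] la2 by exists ('Ind[U] la2).
have el1 : elementary 1 p1 psi1.
  split; last by exists la1.
  by rewrite /posroot p1E; clear -n_ge5; lia.
have el2 : elementary o1.+1 n.-1 psi2.
  split; last by exists la2.
  by rewrite /posroot o1E; clear -n_ge5; lia.
rewrite p1E in el1; rewrite o1E in el2.
exists psi1, psi2, l, j; split=> //; last 2 first.
- by rewrite def_k cfunE cfInd1 // (lin_char1 (linL a)) mulr1 cfSdprod1 indexUS.
- by rewrite def_l.
have [Lla1 _ _] := sla1; have [Lla2 _ _] := sla2; rewrite def_psi1 def_psi2.
have N1 : 'Ind[U] la1 \is a character by rewrite cfInd_char ?lin_charW.
have N2 : 'Ind[U] la2 \is a character by rewrite cfInd_char ?lin_charW.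
have /irrP[t1 def_t1] := lin_char_irr (linL (a.1.1, 0, a.2)).
have /irrP[t2 def_t2] := lin_char_irr (linL (0, a.1.2, 0)).
have /irrP[t def_t] := lin_char_irr (linL a).
rewrite irr_consttE def_l -cfdot_Res_l def_t -irr_consttE.
have -> : 'Res[S] ('Ind[U] la1 * 'Ind[U] la2) =
    'Res[S] ('Ind[U] la1) * 'Res[S] ('Ind[U] la2) by rewrite rmorphM.
have t1E : {in S, forall g,
    'chi_t1 g = 'chi_(a.1.1) (GLval g o p1) * 'chi_(a.2) (GLval g o o1)}.
  by move=> g Sg; rewrite -def_t1 LE // /coord_char /= irr0 cfun1E inE mulr1.
have t2E : {in S, forall g, 'chi_t2 g = 'chi_(a.1.2) (GLval g o1 p)}.
  by move=> g Sg; rewrite -def_t2 LE // /coord_char /= irr0 !cfun1E !inE mulr1 mul1r.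
apply: (@constt_mul _ _ t1 t2); rewrite ?cfRes_char //.
- exact: constt_arm Lla1 la1E t1E.
- have /irrP[v def_v] := lin_char_irr Lla2; rewrite -(cfResRes _ sSV2 sV2U).
  have vV2 : v \in irr_constt ('Res[V2] ('Ind[U] la2)).
    by rewrite def_v constt_Res_Ind_self.
  apply: (constt_Res_trans _ vV2); first by rewrite cfRes_char.
  suff -> : 'Res[S] 'chi_v = 'chi_t2 by rewrite constt_irr inE.
  apply/cfun_inP=> g Sg; rewrite cfResE // -def_v la2E ?(subsetP sSV2) //.
  by rewrite t2E.
apply/cfun_inP=> g Sg; rewrite cfunE t1E // t2E // -def_t LE // /coord_char.
by rewrite mulrAC.
Qed.

End SecondLayer.

(** * The degree bound *)

Section CountCells.

Variable n : nat.
Implicit Types (D E : rel nat).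

Lemma eq_card_cells D E :
    (forall a b : nat, (a < b)%N -> (b <= n.-1)%N -> D a b = E a b) ->
  #|cells n D| = #|cells n E|.
Proof.
move=> eqDE; apply: eq_card => -[r c]; rewrite !inE /=.
by case: (ltnP r c) => //= lt_rc; rewrite eqDE ?leq_ord.
Qed.

Lemma card_triangle_cells (lo hi : nat) : (hi <= n.-1.+1)%N ->
  (2 * #|cells n (fun a b => (lo <= a)%N && (b < hi)%N)| = (hi - lo) * (hi - lo).-1)%N.
Proof.
elim: hi => [_|hi IHhi lt_hi].
  by rewrite (@eq_card_cells _ (fun _ _ => false)) ?cards0 //;
    [rewrite eq_card0 // => p; rewrite !inE andbF | move=> a b _ _; rewrite andbF].
rewrite (@card_cellsID n _ (fun a b => b == hi)).
have [le_hi|lt_lo] := leqP hi lo.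
  have -> : (hi.+1 - lo).-1 = 0%N by lia.
  rewrite muln0 !eq_card0 // => -[r c]; rewrite !inE /=; lia.
rewrite (@card_col_cells n _ (Ordinal lt_hi) lo hi) //=; last lia.
rewrite mulnDr (@eq_card_cells _ (fun a b => (lo <= a)%N && (b < hi)%N)); last lia.
rewrite IHhi ?(ltnW lt_hi) //.
have -> : (hi.+1 - lo).-1 = (hi - lo)%N by lia.
have -> : (hi.+1 - lo = (hi - lo).+1)%N by lia.
by case: (hi - lo)%N => [|d] /=; lia.
Qed.

End CountCells.

Section Bound.
Import GroupScope.
Local Open Scope ring_scope.

Variables (F : finFieldType) (n : nat) (n_ge5 : (5 <= n)%N).
Local Notation I := 'I_n.-1.+1.
Local Notation GL := ({'GL_n[F]} : finGroupType).
Local Notation U := (unitri F n).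
Local Notation pattern := (pattern F n).
Local Notation p := (ord_max : I).

(** The abelian section used for the bound. If the top i entries of the last column
    are in the kernel and i is maximal, then the restriction to the last column
    without its entry i has fixed vectors; modulo that group, the last column, the
    columns from n./2 on in the rows above n./2 other than i, and the column i above
    the diagonal when i < n./2, commute with each other. *)
Definition col_top (i : nat) : rel nat := fun a b => (a < i)%N && (b == n.-1).
Definition col_but (i : nat) : rel nat := fun a b => (b == n.-1) && (a != i).
Definition polar (i : nat) : rel nat := fun a b =>
  [|| b == n.-1, [&& (a < n./2)%N, (n./2 <= b)%N & a != i]
    | [&& (a < i)%N, (i < n./2)%N & b == i]].

Lemma polar_comp i : comp_rel n (polar i) (polar i) (col_but i).
Proof. rewrite /comp_rel /polar /col_but; clear; lia. Qed.

Lemma col_but_polar i a b : col_but i a b -> polar i a b.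
Proof. by rewrite /polar => /andP[->]. Qed.

(** For i < n./2, giving up the row i of the rectangle and adding the column i leaves
    mu n - i cells outside; for larger i the whole rectangle is available. *)
Lemma card_polar i : (1 < i)%N -> (i <= n.-1)%N ->
  (#|cells n (fun a b => true && ~~ polar i a b)| <= mu n - 2)%N.
Proof.
set m := n./2 => i_gt1 le_i; set C := fun a b => _.
have m_gt1 : (1 < m)%N by rewrite /m; clear -n_ge5; lia.
have lt_mn : (m < n.-1)%N by rewrite /m; clear -n_ge5; lia.
have lt_i : (i < n.-1.+1)%N by [].
have := @card_triangle_cells n 0 m (leqW (ltnW lt_mn)).
have := @card_triangle_cells n m n.-1 (leqnSn _).
set right := #|_|; set left := #|_|; rewrite subn0 => right2 left2.
have CE a b : (a < b)%N -> (b <= n.-1)%N -> C a b = [&& b != n.-1,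
    (m <= a)%N || (b < m)%N || (a == i) & ~~ [&& (a < i)%N, (i < m)%N & b == i]].
  by rewrite /C /polar -/m; clear; lia.
have part1 : (#|cells n (fun a b => C a b && (b < m)%N)| + (i < m) * i)%N = left.
  rewrite /left (@card_cellsID n (fun a b => (0 <= a)%N && (b < m)%N)
    (fun a b => (b == i) && (i < m)%N)).
  rewrite addnC; congr (_ + _)%N; last first.
    by apply: eq_card_cells => a b lt_ab le_b; rewrite CE //; clear -lt_ab lt_mn; lia.
  have [lt_im|le_mi] := ltnP i m; last first.
    by rewrite mul0n eq_card0 // => -[r c]; rewrite !inE !andbF.
  rewrite (@card_col_cells n _ (Ordinal lt_i) 0 i) /= ?mul1n ?subn0 //.
  by move=> a b lt_ab _; clear -lt_im lt_ab; lia.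
have part2 : #|cells n (fun a b => C a b && ~~ (b < m)%N)| =
    ((i < m) * (n.-1 - m) + right)%N.
  rewrite (@card_cellsID n _ (fun a b => (a == i) && (i < m)%N)); congr (_ + _)%N.
    have [lt_im|le_mi] := ltnP i m; last first.
      by rewrite mul0n eq_card0 // => -[r c]; rewrite !inE !andbF.
    rewrite (@card_row_cells n _ (Ordinal lt_i) m.-1 n.-1) /=; first 1 last.
    - by clear -m_gt1 lt_mn; lia.
    - by [].
    - by move=> a b lt_ab le_b; rewrite CE //; clear -lt_ab le_b lt_im m_gt1; lia.
    - by clear -lt_im; lia.
    by rewrite mul1n; clear -m_gt1; lia.
  apply: eq_card_cells => a b lt_ab le_b; rewrite CE //; clear -lt_ab le_b; lia.
rewrite (@card_cellsID n C (fun a b => b < m)%N) part2 /mu -/m.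
have := odd_double_half n; rewrite -/m -mul2n.
move: part1 right2 left2; set part := #|_|; clearbody part right left.
have sq1 : (m * m = m * m.-1 + m)%N by clear -m_gt1; case: m m_gt1 => // l _; lia.
have sq2 : (m * m.-1 = m.-1 * m.-1.-1 + 2 * m.-1)%N.
  by clear -m_gt1; case: m m_gt1 => // -[|l] //= _; lia.
case: (odd n) => /= part1 right2 left2 def_n.
  have Em : (n.-1 - m = m)%N by clear -def_n; lia.
  rewrite Em in right2 *; rewrite -mulnn.
  by case: (ltnP i m) part1 => /= [lt_im|le_mi] part1;
    clear -part1 right2 left2 sq1 i_gt1 m_gt1; lia.
have Em : (n.-1 - m = m.-1)%N by clear -def_n m_gt1; lia.
have m_gt2 : (2 < m)%N by clear -def_n n_ge5; lia.
rewrite Em in right2 *.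
by case: (ltnP i m) part1 => /= [lt_im|le_mi] part1;
  clear -part1 right2 left2 sq2 i_gt1 m_gt2; lia.
Qed.

Let col_top_comp i : comp_rel n (col_top i) (col_top i) (col_top i).
Proof. by rewrite /comp_rel /col_top; clear; lia. Qed.

Let col_but_comp i : comp_rel n (col_but i) (col_but i) (col_but i).
Proof. by rewrite /comp_rel /col_but; clear; lia. Qed.

Let polar_closed i : comp_rel n (polar i) (polar i) (polar i).
Proof.
by move=> a b c l1 l2 l3 D1 D2; apply: col_but_polar; apply: polar_comp l1 l2 l3 D1 D2.
Qed.

Let polar_l i : comp_rel n (polar i) (col_but i) (col_but i).
Proof.
by move=> a b c l1 l2 l3 D1 /col_but_polar D2; apply: polar_comp l1 l2 l3 D1 D2.
Qed.

Let polar_r i : comp_rel n (col_but i) (polar i) (col_but i).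
Proof.
by move=> a b c l1 l2 l3 /col_but_polar D1 D2; apply: polar_comp l1 l2 l3 D1 D2.
Qed.

Lemma corner_col_bound (k : Iirr U) : pattern (corner_col n) \subset cfker 'chi_k ->
  'chi_k 1%g <= (#|F| ^ (mu n - 2))%:R.
Proof.
move=> kerL; pose P i := (i <= n.-1)%N && (pattern (col_top i) \subset cfker 'chi_k).
have P2 : P 2.
  apply/andP; split; first by clear -n_ge5; lia.
  by apply: subset_trans kerL; apply: pattern_sub; rewrite /col_top /corner_col.
have P_le i : P i -> (i <= n.-1)%N by case/andP.
case: (@ex_maxnP P n.-1 (ex_intro _ 2 P2) P_le) => i /andP[le_i kerZ] max_i.
have i_gt1 : (1 < i)%N := max_i 2 P2.
pose Q := pattern_group F (polar_closed (i := i)).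
pose A := pattern_group F (col_but_comp (i := i)).
pose Z := pattern_group F (col_top_comp (i := i)).
have sQU : Q \subset U := pattern_unitri _ _ _.
have sAQ : A \subset Q.
  by apply: pattern_sub => a b _ _; apply: col_but_polar.
have nAQ : A <| Q.
  rewrite /normal sAQ; apply: pattern_norm; first exact: polar_closed.
    exact: polar_l.
  exact: polar_r.
have sZA : Z \subset A.
  by apply: pattern_sub => a b _ _ /andP[lt_ai Eb]; rewrite /col_but Eb ltn_eqF.
have cQQ : [~: Q, Q] \subset A.
  apply: pattern_commg; by [apply: col_but_comp | apply: polar_closed |
    apply: polar_comp | apply: polar_l].
have lt_i : (i < n.-1.+1)%N by [].
pose r : I := Ordinal lt_i.
have vanA x : x \in A -> x \notin Z -> 'chi_k x = 0.
  move=> Ax nZx; have /patternE[Ux zx] := Ax.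
  have [j /and3P[gt_ij lt_jp nz_j]|no_j] :=
      pickP (fun j : I => [&& (i < j)%N, (j < p)%N & GLval x j p != 0]); last first.
    case/negP: nZx; apply/patternE; split=> // a b lt_ab nZab.
    apply/eqP/idPn => nz; have /andP[/eqP Eb ne_a] : col_but i a b.
      by apply: contraR nz => /zx->.
    have bE : b = p by apply/val_inj.
    have lt_ia : (i < a)%N.
      by rewrite ltn_neqAle eq_sym ne_a leqNgt; apply: contra nZab => lt_ai;
        rewrite /col_top lt_ai Eb eqxx.
    by have := no_j a; rewrite lt_ia -bE lt_ab nz.
  have lt_ip : (i < n.-1)%N by apply: ltn_trans gt_ij _.
  have /cfkerPn[w Ww ne_w] : ~~ (pattern (col_top i.+1) \subset cfker 'chi_k).
    apply/negP=> ker_i1.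
    by have := max_i i.+1; rewrite /P lt_ip ker_i1 => /(_ isT); rewrite ltnn.
  apply: (@irr_vanish_row F n k x r j (col_top i.+1)) => //.
  - move=> a; have [le_ra|lt_ar] := leqP r a; first by have /unitriP-> := Ux.
    rewrite zx -?val_eqE ?(ltn_eqF lt_ar) //=.
    by rewrite /col_but negb_and neq_ltn lt_ip.
  - move=> c lt_jc nz; rewrite /col_top leqnn /=.
    by have /andP[->] : col_but i j c by apply: contraR nz => /zx->.
  - apply: (pattern_cfcenter _ _ _ _ _ kerZ);
      rewrite /comp_rel /col_top; clear; lia.
  exists (GLval w r p / GLval x j p) => z Wz row_z.
  rewrite (irr_eq_mod (r := r) (c := p) (col_top_comp (i := i.+1)) _ _ _ kerZ Wz Ww) //.
  - by move=> l _ lt_lp /andP[_ /eqP El]; rewrite El ltnn in lt_lp.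
  - by move=> a b _ _; rewrite /col_top /=; clear; lia.
  by rewrite row_z // lt_jp divfK.
have k0 : (0 : Iirr A) \in irr_constt ('Res[A] 'chi_k).
  rewrite irr_consttE irr0; apply: contraNneq (irr1_neq0 k) => d0.
  by rewrite -(Hecke_cfdot sQU nAQ sZA kerZ vanA) d0 mul0r.
apply: le_trans (irr_deg_le_index nAQ sQU cQQ k0) _.
have cT : comp_rel n (fun _ _ => true) (fun _ _ => true) (fun _ _ => true) by [].
rewrite ler_nat /= unitri_pattern (index_pattern F cT (polar_closed (i := i))) //.
apply: leq_pexp2l; last exact: card_polar.
by apply/card_gt0P; exists 0.
Qed.

End Bound.

(** * The antidiagonal automorphism and the diagonal blocks *)

Section Isomorphisms.
Import GroupScope.
Local Open Scope ring_scope.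

Lemma card_isom_Iirr (aT rT : finGroupType) (G : {group aT}) (R : {group rT})
    (f : {morphism G >-> rT}) (isoGR : isom G R f) (d : algC) :
  #|[set j : Iirr G | 'chi_j 1%g == d]| = #|[set j : Iirr R | 'chi_j 1%g == d]|.
Proof.
rewrite -(card_imset _ (isom_Iirr_inj isoGR)); apply: eq_card => j.
apply/imsetP/idP => [[i] /[!inE] di ->|]; first by rewrite isom_IirrE cfIsom1.
rewrite inE => dj; exists (isom_Iirr (isom_sym isoGR) j); last by rewrite isom_IirrKV.
by rewrite inE isom_IirrE cfIsom1.
Qed.

Lemma inj_card_isom (aT rT : finGroupType) (G : {group aT}) (R : {group rT})
    (f : {morphism G >-> rT}) :
    {in G, forall x, f x \in R} -> {in G &, injective f} -> #|G| = #|R| ->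
  isom G R f.
Proof.
move=> fR injf eqGR; apply/isomP; have injmf : 'injm f by apply/injmP.
split=> //; apply/eqP; rewrite eqEcard card_injm // eqGR leqnn andbT.
by apply/subsetP=> _ /morphimP[x _ Gx ->]; apply: fR.
Qed.

Variable F : finFieldType.

Section Flip.

Variable n : nat.
Local Notation I := 'I_n.-1.+1.
Local Notation M := 'M[F]_n.-1.+1.
Local Notation GL := ({'GL_n[F]} : finGroupType).
Local Notation U := (unitri F n).

Definition flip (X : M) : M := \matrix_(r, c) X (rev_ord c) (rev_ord r).

Lemma flipM X Y : flip (X *m Y) = flip Y *m flip X.
Proof.
apply/matrixP=> r c; rewrite !mxE (reindex_inj rev_ord_inj) /=.
by apply: eq_bigr => k _; rewrite !mxE mulrC.
Qed.

Lemma flipK : involutive flip.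
Proof. by move=> X; apply/matrixP=> r c; rewrite !mxE !rev_ordK. Qed.

Lemma flip_unitri g : g \in U -> unitri_mx (flip (GLval g)).
Proof.
move=> /unitriP Ug; apply/unitri_mxP=> r c le_cr; rewrite mxE Ug /=; last first.
  by rewrite leq_sub2l // ltnS.
by rewrite (inj_eq rev_ord_inj) eq_sym.
Qed.

Definition flipV (g : GL) : GL := toGL (flip (GLval g^-1%g)).

Lemma flipVE g : g \in U -> GLval (flipV g) = flip (GLval g^-1%g).
Proof. by move=> Ug; rewrite toGLK // flip_unitri // groupV. Qed.

Lemma flipVM : {in U &, {morph flipV : g h / (g * h)%g}}.
Proof.
move=> g h Ug Uh; apply: val_inj; rewrite -[LHS]/(GLval _) -[RHS]/(GLval _).
by rewrite GL_MxE !flipVE ?groupM // invMg GL_MxE flipM.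
Qed.

(** Reflection in the antidiagonal reverses products, and so does inversion; their
    composition is an automorphism that exchanges the first row and the last column. *)
Lemma flipV_isom : isom U U (Morphism flipVM).
Proof.
apply: inj_card_isom => // [g Ug | g h Ug Uh eq_gh].
  by rewrite inE [_ g]/(flipV g) flipVE // flip_unitri // groupV.
have : GLval (flipV g) = GLval (flipV h) by congr (GLval _); apply: eq_gh.
rewrite !flipVE // => /(can_inj flipK) eqV.
by apply: invg_inj; apply: val_inj.
Qed.

Lemma corner_row_bound (n_ge5 : (5 <= n)%N) (k : Iirr U) :
    pattern F n (corner_row n) \subset cfker 'chi_k ->
  'chi_k 1%g <= (#|F| ^ (mu n - 2))%:R.
Proof.
move=> kerT; rewrite -(cfIsom1 flipV_isom) -isom_IirrE.
apply: corner_col_bound => //; rewrite isom_IirrE; apply/subsetP=> h Lh.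
have /(subsetP (pattern_unitri F n (corner_col n))) Uh := Lh.
have /isomP[_ im_f] := flipV_isom.
have : h \in Morphism flipVM @* U by rewrite im_f.
case/morphimP=> g _ Ug def_h.
have Tg : g^-1%g \in pattern F n (corner_row n).
  apply/patternE; split; first by rewrite groupV.
  move=> r c lt_rc nT; have /patternE[_ zh] := Lh.
  have := zh (rev_ord c) (rev_ord r).
  rewrite def_h /= flipVE // mxE !rev_ordK; apply.
    by rewrite /=; have := ltn_ord c; clear -lt_rc; lia.
  apply: contra nT; have := ltn_ord r; have := ltn_ord c; move: lt_rc.
  by rewrite /corner_col /corner_row /=; clear -n_ge5; lia.
have {}Tg : g \in pattern_group F (corner_row_comp n_ge5) by rewrite -groupV.
rewrite -isom_IirrE cfkerEirr inE isom_IirrE def_h cfIsomE // cfIsom1.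
by have := subsetP kerT g Tg; rewrite cfkerEirr inE.
Qed.

End Flip.

Section Block.

Variables n s k : nat.
Hypotheses (k_gt0 : (0 < k)%N) (le_skn : (s + k <= n)%N).
Local Notation U := (unitri F n).
Local Notation GL := ({'GL_n[F]} : finGroupType).

Definition shift (r : 'I_k.-1.+1) : 'I_n.-1.+1 := inord (s + r).

Lemma shiftE r : shift r = (s + r)%N :> nat.
Proof.
rewrite inordK //; have := ltn_ord r; clear -k_gt0 le_skn; lia.
Qed.

Definition window (g : GL) : {'GL_k[F]} :=
  toGL (\matrix_(r, c) GLval g (shift r) (shift c)).

Lemma windowE g r c : g \in U ->
  GLval (window g) r c = GLval g (shift r) (shift c).
Proof.
move=> /unitriP Ug; rewrite toGLK ?mxE //.
apply/unitri_mxP=> a b le_ba; rewrite mxE Ug ?shiftE ?leq_add2l //.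
by rewrite -!val_eqE /= !shiftE eqn_add2l.
Qed.

Lemma shift_inj : injective shift.
Proof.
move=> r c /(congr1 (@nat_of_ord _)); rewrite !shiftE => /addnI.
exact: val_inj.
Qed.

Lemma windowM : {in U &, {morph window : g h / (g * h)%g}}.
Proof.
move=> g h Ug Uh; apply: val_inj; apply/matrixP=> r c; rewrite -!/(GLval _).
rewrite windowE ?groupM // !GL_MxE !mxE (bigID (mem (shift @: setT))) /=.
rewrite [X in _ + X]big1 ?addr0 => [|l out_l].
  rewrite big_imset /=; last by move=> a b _ _; apply: shift_inj.
  apply: eq_big => [a|a _]; first by rewrite inE.
  by rewrite -!/(GLval _) !windowE.
apply: unitri_mul0 => //; apply: contra out_l; rewrite !shiftE => /andP[le1 le2].
have lt_l : (l - s < k.-1.+1)%N by have := ltn_ord c; clear -le1 le2; lia.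
apply/imsetP; exists (Ordinal lt_l) => //; apply/val_inj.
by rewrite -[RHS]/(nat_of_ord _) shiftE /= subnKC // (leq_trans _ le1) // leq_addr.
Qed.

Lemma card_block_cells :
  #|cells n (blk s.+1 (s + k).-1)| = #|cells k (fun _ _ => true)|.
Proof.
apply/eqP; rewrite -(eqn_pmul2l (isT : 0 < 2)%N); apply/eqP.
rewrite (@eq_card_cells n _ (fun a b => (s <= a)%N && (b < s + k)%N)).
  rewrite card_triangle_cells; last by clear -le_skn; lia.
  rewrite (@eq_card_cells k _ (fun a b => (0 <= a)%N && (b < k)%N)).
    by rewrite card_triangle_cells ?subn0 ?addKn // leqSpred.
  by move=> a b _ le_b; clear -le_b k_gt0; lia.
by move=> a b _ _; rewrite /blk; clear -k_gt0; lia.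
Qed.

(** Cutting out a diagonal block of consecutive rows is multiplicative on upper
    triangular matrices, and it is injective on the corresponding block subgroup. *)
Lemma nchar_Ublock (d : nat) :
  #|[set j : Iirr (Ublock F n s.+1 (s + k).-1) | 'chi_j 1%g == d%:R]| =
  #|[set j : Iirr (unitri F k) | 'chi_j 1%g == d%:R]|.
Proof.
have sBU : Ublock F n s.+1 (s + k).-1 \subset U.
  by rewrite Ublock_pattern pattern_unitri.
have fM : {in Ublock_group F n s.+1 (s + k).-1 &, {morph window : g h / (g * h)%g}}.
  by move=> g h Bg Bh; apply: windowM; apply: (subsetP sBU).
apply: (@card_isom_Iirr _ _ _ (unitri_group F k) (Morphism fM)); apply: inj_card_isom.
- move=> g /(subsetP sBU) Ug /=; apply/unitriP=> a b le_ba.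
  have /unitriP Ug' := Ug; rewrite windowE // Ug' ?shiftE ?leq_add2l //.
  by rewrite (inj_eq shift_inj).
- move=> g h Bg Bh /= eq_gh.
  have [Ug Uh] := (subsetP sBU g Bg, subsetP sBU h Bh).
  rewrite /= Ublock_pattern in Bg Bh; apply: (pattern_eq Bg Bh) => r c lt_rc.
  rewrite /blk ltnS => /andP[le_sr le_c].
  have lt_r : (r - s < k.-1.+1)%N by clear -lt_rc le_sr le_c; lia.
  have lt_c : (c - s < k.-1.+1)%N by clear -lt_rc le_sr le_c; lia.
  have rE : r = shift (Ordinal lt_r).
    by apply/val_inj; rewrite -[RHS]/(nat_of_ord _) shiftE /= subnKC.
  have cE : c = shift (Ordinal lt_c).
    apply/val_inj; rewrite -[RHS]/(nat_of_ord _) shiftE /= subnKC //.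
    exact: leq_trans (ltnW lt_rc).
  by rewrite rE cE -!windowE // eq_gh.
by rewrite /= Ublock_pattern unitri_pattern !card_pattern card_block_cells.
Qed.

End Block.

End Isomorphisms.

(** * The second largest degree *)

Lemma mu_rec m : mu m.+2 = (m + mu m)%N.
Proof.
rewrite /mu /= negbK; have := odd_double_half m; rewrite -mul2n.
case: (odd m) => /=; first by rewrite -!mulnn; lia.
by case: (m./2) => [|l] /=; lia.
Qed.

Lemma mu_rec2 (n : nat) : (5 <= n)%N ->
  (mu n - 1 = n - 2 + (mu (n - 2) - 1))%N
  /\ (mu n - 1 = 2 * n - 7 + mu (n - 4))%N.
Proof.
case: n => [|[|[|[|[|n]]]]] // _; rewrite subn2 /=.
have -> : (n.+4.+1 - 4 = n.+1)%N by lia.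
by rewrite (mu_rec n.+3) (mu_rec n.+1); split; lia.
Qed.

(** In the remaining cases the character is trivial on one of the two neighbours of
    the corner, and its degree is too small. *)
Lemma nontriv_cases (F : finFieldType) (n : nat) (k : Iirr (unitri F n)) :
    (5 <= n)%N -> 'chi_k 1%g = (#|F| ^ (mu n - 1))%:R ->
  neighbours_nontriv k = ~~ corner_nontriv k.
Proof.
move=> n_ge5 deg_k; rewrite /neighbours_nontriv /corner_nontriv negbK.
have deg_gt : ~~ ('chi_k 1%g <= (#|F| ^ (mu n - 2))%:R :> algC).
  rewrite deg_k ler_nat -ltnNge ltn_exp2l.
    by have [] := mu_rec2 n_ge5; clear -n_ge5; lia.
  by rewrite -cardsT (cardsD1 0) (cardsD1 1) !inE oner_eq0.
case: (_ \subset _) => //=; apply/andP; split; apply: contra deg_gt.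
  exact: corner_row_bound.
exact: corner_col_bound.
Qed.

Theorem lemma4p2p1 (q n : nat) (F : finFieldType) (Fq : #|F| = q)
    (n_ge5 : (5 <= n)%N) :
  (forall chi : 'CF(unitri F n),
     chi \in irr (unitri F n) ->
     chi 1%g = (q ^ (mu n - 1))%:R ->
     (exists (i j : nat) (psi : 'CF(unitri F n))
             (phi : 'CF(Ublock F n 2 (n - 2))),
        [/\ elementary i j psi,
            almost_faithful psi,
            phi \in irr (Ublock F n 2 (n - 2)),
            phi 1%g = (q ^ (mu (n - 2) - 1))%:R &
            chi = psi * infl phi])
     \/
     (exists (psi1 psi2 : 'CF(unitri F n)) (k : Iirr (unitri F n))
             (phi : 'CF(Ublock F n 3 (n - 3))),
        [/\ elementary 1 (n - 2) psi1 /\ elementary 2 (n - 1) psi2,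
            k \in irr_constt (psi1 * psi2),
            phi \in irr (Ublock F n 3 (n - 3)),
            phi 1%g = (q ^ mu (n - 4))%:R &
            chi = 'chi_k * infl phi]))
  /\
  nchar F n (mu n - 1) =
    ((q - 1) * nchar F (n - 2) (mu (n - 2) - 1)
     + q * (q - 1) ^ 2 * nchar F (n - 4) (mu (n - 4)))%N.
Proof.
have [mu1 mu2] := mu_rec2 n_ge5.
have nz_q e : (#|F| ^ e)%:R != 0 :> algC.
  rewrite pnatr_eq0 expn_eq0 negb_and -lt0n; apply/orP; left.
  by apply/card_gt0P; exists 0.
have n_ge3 : (3 <= n)%N by apply: leq_trans n_ge5.
have [form1 card1] := almost_faithful_irr F n_ge3.
have [form2 card2] := second_layer_irr F n_ge5.
rewrite -Fq; split=> [chi /irrP[k ->] deg_k|].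
  have [gk|ngk] := boolP (corner_nontriv k).
    left; have [psi [j [el af dj def_k]]] := form1 k gk.
    exists 1%N, n.-1, psi, 'chi_j; split=> //; first exact: mem_irr.
    apply: (mulfI (nz_q (n - 2)%N)).
    by rewrite -dj deg_k mu1 expnD natrM.
  right; have gk : neighbours_nontriv k by rewrite (nontriv_cases n_ge5).
  have [psi1 [psi2 [l [j [el cl dj def_k]]]]] := form2 k gk.
  exists psi1, psi2, l, 'chi_j; rewrite subn1 subn2.
  split=> //; first exact: mem_irr.
  apply: (mulfI (nz_q (2 * n - 7)%N)).
  by rewrite -dj deg_k mu2 expnD natrM.
rewrite /nchar.
have b1 : (1 + (n - 2)).-1 = (n - 2)%N by lia.
have b2 : (2 + (n - 4)).-1 = (n - 3)%N by lia.
have := @nchar_Ublock F n 1 (n - 2) _ _ (#|F| ^ (mu (n - 2) - 1));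
  rewrite b1 => <-; try lia.
have := @nchar_Ublock F n 2 (n - 4) _ _ (#|F| ^ mu (n - 4));
  rewrite b2 => <-; try lia.
rewrite -card1 -card2 -expnD -mu1 -expnD -mu2.
set D := [set k | _]; rewrite -(cardsID [set k | corner_nontriv k] D).
congr (_ + _)%N; apply: eq_card => k; rewrite !inE; first by rewrite andbC.
case: eqP => [deg_k|_]; last by rewrite !andbF.
by rewrite !andbT (nontriv_cases n_ge5).
Qed.
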